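(* Let $T>0$, let $g:[0,T]\to\mathbb{R}$ be continuous and let $(W_t)$ be a standard Brownian motion. Let $(\mu_n)$ be a sequence of Schwartz distributions on $\mathbb{R}$ with compact supports contained in $[g(T),+\infty)$ such that: (i) for every $0\le t<T$, $U(g(t),t;\mu_n)\to 1$ as $n\to\infty$; and (ii) for some constant $c$, $|U(w,t;\mu_n)|\le c$ for all $n$, all $0\le t<T$ and all $w\le g(t)$. Then, for every real $u\le g(0)$, $U(u,0;\mu_n)\to P(\tau(u)<T)$ as $n\to\infty$.
   Context: $N(x)=(2\pi)^{-1/2}\int_{-\infty}^x e^{-s^2/2}\,ds$ is the standard normal distribution function. $(W_t)$ starts at $W_0=0$. For a real number $u$, $\tau(u)=\inf\{t\in[0,T): u+W_t=g(t)\}$ if such a $t$ exists, and $\tau(u)=T$ otherwise. For a compactly supported Schwartz distribution $\mu$ on $\mathbb{R}$, $\int\phi(v)\,d\mu(v)$ denotes the pairing of $\mu$ with a $C^\infty$ function $\phi$. For $u\in\mathbb{R}$, $U(u,t;\mu)=\int N\left(\frac{u-v}{\sqrt{T-t}}\right)d\mu(v)$ if $0\le t<T$, and $U(u,t;\mu)=0$ if $t=T$. *)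

(* Defs.v *)
From HB Require Import structures.
From mathcomp Require Import all_boot all_order all_algebra.
From mathcomp Require Import all_classical all_reals all_analysis.

Set Implicit Arguments.
Unset Strict Implicit.
Unset Printing Implicit Defensive.

Import Order.TTheory GRing.Theory Num.Theory.
Import numFieldNormedType.Exports.
Local Open Scope classical_set_scope.
Local Open Scope ring_scope.

Section Distributions.
Context {R : realType}.
Implicit Types (f phi psi chi : R -> R) (K V : set R).

Definition smooth f := forall (n : nat) (x : R), derivable (derive1n n f) x 1.

Definition fun_supp f : set R := closure [set x | f x != 0].

Definition test_function phi := smooth phi /\ compact (fun_supp phi).

Definition sup_norm f : R := sup (range (fun x => `|f x|)).

(* Real-valued Schwartz distributions: linear forms on the test functions that
   satisfy, over each compact set, an estimate of finite order.  The values of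
   [dist_fun] outside the test functions are never used. *)
Record schwartz_distribution := SchwartzDistribution {
  dist_fun :> (R -> R) -> R ;
  dist_linear : forall (a : R) phi psi,
    test_function phi -> test_function psi ->
    dist_fun (fun x => a * phi x + psi x) = a * dist_fun phi + dist_fun psi ;
  dist_continuous : forall K, compact K ->
    exists (C : R) (m : nat), forall phi,
      test_function phi -> fun_supp phi `<=` K ->
      `|dist_fun phi| <= C * \sum_(k < m.+1) sup_norm (derive1n k phi) }.

Implicit Type mu : schwartz_distribution.

Definition vanishes_on mu V :=
  forall phi, test_function phi -> fun_supp phi `<=` V -> mu phi = 0.

Definition dist_supp mu : set R :=
  ~` (\bigcup_(V in [set V | open V /\ vanishes_on mu V]) V).

Definition is_cutoff mu chi :=
  test_function chi /\
  exists2 V, open V /\ dist_supp mu `<=` V & forall x, V x -> chi x = 1.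

Definition cutoff mu : R -> R := get (is_cutoff mu).

(* Pairing of a compactly supported distribution with a smooth function [phi],
   which need not have compact support: [mu] is applied to [chi * phi], where
   [chi] is a test function equal to 1 near the support of [mu].  The value
   does not depend on the choice of [chi]. *)
Definition pairing mu phi : R := mu (fun x => cutoff mu x * phi x).

End Distributions.

Arguments schwartz_distribution : clear implicits.

Section Brownian.
Context {R : realType}.

Record brownian_motion {d : measure_display} {Omega : measurableType d}
    (P : probability Omega R) (W : R -> Omega -> R) : Prop := {
  bm_measurable : forall t : R, 0 <= t -> measurable_fun [set: Omega] (W t) ;
  bm_start : forall w, W 0 w = 0 ;
  bm_continuous : forall w, {within `[0, +oo[, continuous (fun t => W t w)} ;
  bm_gaussian : forall s t : R, 0 <= s -> s < t ->
    forall B : set R, measurable B ->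
    P [set w | B (W t w - W s w)] = normal_prob 0 (Num.sqrt (t - s)) B ;
  bm_independent : forall (n : nat) (t : nat -> R) (B : nat -> set R),
    0 <= t 0%N -> (forall i, (i < n)%N -> t i <= t i.+1) ->
    (forall i, (i < n)%N -> measurable (B i)) ->
    P [set w | forall i, (i < n)%N -> B i (W (t i.+1) w - W (t i) w)] =
    (\prod_(i < n) P [set w | B i (W (t i.+1) w - W (t i) w)%R])%E }.

(* Hitting time of the boundary [g] by [u + w], for a single path [w]. *)
Definition hitting_time (T : R) (g w : R -> R) (u : R) : R :=
  let hits := [set t | 0 <= t < T /\ u + w t = g t] in
  if `[< hits !=set0 >] then inf hits else T.

Definition normal_cdf (x : R) : R :=
  (Num.sqrt (2 * pi))^-1 *
  \int[lebesgue_measure]_(s in `]-oo, x]) expR (- (s ^+ 2) / 2).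

Definition U (T u t : R) (mu : schwartz_distribution R) : R :=
  if t < T then pairing mu (fun v => normal_cdf ((u - v) / Num.sqrt (T - t)))
  else 0.

End Brownian.

(* Main.v *)
Require Import Defs.
From HB Require Import structures.
From mathcomp Require Import all_boot all_order all_algebra.
From mathcomp Require Import all_classical all_reals all_analysis measurable_realfun.
From mathcomp Require Import ring lra.

Set Implicit Arguments.
Unset Strict Implicit.
Unset Printing Implicit Defensive.

Import Order.TTheory GRing.Theory Num.Theory.
Import numFieldNormedType.Exports.
Local Open Scope classical_set_scope.
Local Open Scope ring_scope.

(** Why the theorem holds.  For one distribution [mu], put
    F(x, t) = U(x, t; mu).  Since [v |-> N((x - v) / sqrt (T - t))] is the
    probability that a Brownian motion at [x] at time [t] ends above [v], the
    process [F(u + W_t, t)], for [t < T], is a martingale.  Stopping it at the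
    hitting time tau gives

      U(u, 0; mu) = E [ F(g(tau), tau) ; tau < T ],

    because on the event tau = T the path ends strictly below [g(T)] almost
    surely, at a distance from the support of [mu], where F tends to 0 as [t]
    tends to [T].  Now let [mu] run through the sequence: on tau < T the
    integrand tends to 1 by (i), it is bounded by (ii), and bounded convergence
    gives the limit P(tau < T).

    A distribution is not a measure, so every analytic property of F rests on
    one estimate, [pairing_estimate]: the pairing of [mu] with a smooth function
    is controlled by finitely many derivatives of that function on a compact
    interval whose left end may be any point below the support of [mu].  It
    needs cutoffs, hence a smooth step function, and the fact that [mu] kills
    test functions supported off its support ([dist_vanish]).  Inserting the
    derivatives of the heat kernel, which are polynomials times a Gaussian, it
    yields boundedness, continuity and decay of F ([U_bounded], [U_continuous],
    [U_decay]).

    The martingale property splits into the identity that F at time [s] is the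
    Gaussian average of F at time [t] ([U_semigroup]) and the Markov property.
    For the first, [mu] has to be exchanged with an integral; this is done
    through quadrature sums that are accurate uniformly over all functions with
    given bounds ([quadrature]).  The convolution identity for the kernel itself
    is read off from the Brownian motion ([heat_convolution]).  The Markov
    property comes from the independence of an increment from the sigma-algebra
    of the past, which Dynkin's lemma extracts from the independence of finitely
    many increments ([past_indep], [markov_property]).

    Optional stopping is done by hand.  On a finite grid of [[0, s]], [s < T],
    the sum of the increments of F over the steps at whose beginning the
    boundary has not been hit has mean 0, and it telescopes to F at the hitting
    time rounded up to the grid.  Refining the grid gives
    E F(u + W_(tau /\ s), tau /\ s) = F(u, 0) ([stopped_mean]), and [s]
    tending to [T] gives the displayed formula ([stopped_limit]). *)

(** * Smooth functions *)

Section SmoothFunctions.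
Context {R : realType}.
Implicit Types (f g : R -> R) (x : R).

(** Finite-order differentiability by recursion on the derivative: closure
    under products, inverses and affine substitutions becomes an induction
    on [n], without Leibniz or Faa di Bruno formulas. *)
Fixpoint Cn n f : Prop :=
  if n is m.+1 then exists2 f', (forall x, is_derive x 1 f (f' x)) & Cn m f'
  else True.

Lemma smoothE f : smooth f <-> forall n, Cn n f.
Proof.
split=> [sf n|].
  elim: n f sf => [//|n IH] f sf /=.
  exists (f^`())%classic; first by move=> x; rewrite derive1E; apply/derivableP/(sf 0%N).
  by apply: IH => k x; rewrite -derive1Sn; exact: sf.
move=> Cf n; elim: n f Cf => [|n IH] f Cf x.
  by have [f' /(_ x) []] := Cf 1%N.
rewrite derive1Sn; apply: IH => m.
have [f' df Cf'] := Cf m.+1.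
suff -> : (f^`())%classic = f' by [].
by apply/funext => y; rewrite derive1E; exact: (@derive_val _ _ _ _ _ _ _ (df y)).
Qed.

Lemma CnW n f : Cn n.+1 f -> Cn n f.
Proof.
elim: n f => [//|n IH] f [f' df Cf'].
by exists f' => //; exact: IH.
Qed.

Lemma CnD n f g : Cn n f -> Cn n g -> Cn n (f \+ g).
Proof.
elim: n f g => [//|n IH] f g [f' df Cf'] [g' dg Cg'] /=.
by exists (f' \+ g') => [x|]; [exact: is_deriveD|exact: IH].
Qed.

Lemma CnM n f g : Cn n f -> Cn n g -> Cn n (f \* g).
Proof.
elim: n f g => [//|n IH] f g Cf Cg.
have := CnW Cf; have := CnW Cg.
move: Cf Cg => [f' df Cf'] [g' dg Cg'] Cg Cf /=.
exists ((f \* g') \+ (g \* f')) => [x|].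
  by apply: is_derive_eq.
by apply: CnD; exact: IH.
Qed.

Lemma Cn_cst n (a : R) : Cn n (fun=> a).
Proof.
elim: n a => [//|n IH] a /=.
by exists (fun=> 0) => [x|//]; exact: is_derive_cst.
Qed.

Lemma CnV n f : (forall x, f x != 0) -> Cn n f -> Cn n (fun x => (f x)^-1).
Proof.
move=> f0; elim: n => [//|n IH] Cf.
have Cfn := CnW Cf; have := IH Cfn => CV.
move: Cf => [f' df Cf'] /=.
exists (((fun x => -1) \* ((fun x => (f x)^-1) \* (fun x => (f x)^-1))) \* f') => [x|].
  apply: is_derive_eq.
  by rewrite /= mulN1r -exprVn expr2.
apply: CnM => //; apply: CnM; [exact: Cn_cst|exact: CnM].
Qed.

Lemma Cn_affine n f (a b : R) : Cn n f -> Cn n (fun x => f (a * x + b)).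
Proof.
elim: n f => [//|n IH] f [f' df Cf'] /=.
exists ((fun=> a) \* (fun x => f' (a * x + b))) => [x|].
  have dh : is_derive x 1 (fun x => a * x + b : R) (a *: 1 + 0).
    exact: (@is_deriveD _ _ _ (a *: @id R) (cst b) x 1 (a *: 1) 0
      (@is_deriveZ _ _ _ (@id R) a x 1 1 (is_derive_id x 1)) (is_derive_cst b x 1)).
  have dc := @is_derive1_comp _ f (fun x => a * x + b) x _ _ (df _) dh.
  apply: (@is_derive_eq _ _ _ _ _ _ _ _ dc).
  by rewrite /= addr0 /GRing.scale /= mulr1 mulrC.
by apply: CnM; [exact: Cn_cst|exact: IH].
Qed.

Lemma smooth_cst (a : R) : smooth (fun=> a).
Proof. by apply/smoothE => n; exact: Cn_cst. Qed.

Lemma smoothD f g : smooth f -> smooth g -> smooth (fun x => f x + g x).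
Proof. by move=> /smoothE sf /smoothE sg; apply/smoothE => n; exact: CnD. Qed.

Lemma smoothM f g : smooth f -> smooth g -> smooth (fun x => f x * g x).
Proof. by move=> /smoothE sf /smoothE sg; apply/smoothE => n; exact: CnM. Qed.

Lemma smoothV f : (forall x, f x != 0) -> smooth f -> smooth (fun x => (f x)^-1).
Proof. by move=> f0 /smoothE sf; apply/smoothE => n; exact: CnV. Qed.

Lemma smooth_affine f (a b : R) : smooth f -> smooth (fun x => f (a * x + b)).
Proof. by move=> /smoothE sf; apply/smoothE => n; exact: Cn_affine. Qed.

Lemma smoothZ (a : R) f : smooth f -> smooth (fun x => a * f x).
Proof. by apply: smoothM; exact: smooth_cst. Qed.

Lemma smooth_deriv f : smooth f -> smooth (f^`())%classic.
Proof. by move=> sf n x; rewrite -derive1Sn; exact: sf. Qed.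

Lemma smooth_is_derive f n x : smooth f ->
  is_derive x 1 (derive1n n f) (derive1n n.+1 f x).
Proof.
by move=> sf; rewrite derive1nS derive1E; apply/derivableP/sf.
Qed.

(** A function listed together with its successive derivatives.  The
    derivatives of the heat kernel are known in closed form, and a tower
    transfers that knowledge to [derive1n]. *)
Definition tower (F : nat -> R -> R) :=
  forall n x, is_derive x 1 (F n) (F n.+1 x).

Lemma tower_derive1n F n : tower F -> derive1n n (F 0%N) = F n.
Proof.
move=> dF; elim: n => [//|n IH]; rewrite derive1nS IH; apply/funext => x.
by rewrite derive1E; exact: (@derive_val _ _ _ _ _ _ _ (dF n x)).
Qed.

Lemma tower_smooth F : tower F -> smooth (F 0%N).
Proof. by move=> dF n x; rewrite tower_derive1n//; have [] := dF n x. Qed.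

Lemma derive1nD n f g : smooth f -> smooth g ->
  derive1n n (fun x => f x + g x) = fun x => derive1n n f x + derive1n n g x.
Proof.
move=> sf sg.
apply: (@tower_derive1n (fun n x => derive1n n f x + derive1n n g x) n) => m x.
by apply: is_deriveD; exact: smooth_is_derive.
Qed.

Lemma derive1nZ n (a : R) f : smooth f ->
  derive1n n (fun x => a * f x) = fun x => a * derive1n n f x.
Proof.
move=> sf.
apply: (@tower_derive1n (fun n x => a * derive1n n f x) n) => m x.
by apply: is_deriveZ; exact: smooth_is_derive.
Qed.

Lemma derive1M f g : smooth f -> smooth g ->
  ((fun x => f x * g x)^`())%classic =
  (fun x => f x * g^`()%classic x + f^`()%classic x * g x).
Proof.
move=> sf sg; apply/funext => x; rewrite derive1E.
have df := smooth_is_derive 0 x sf; have dg := smooth_is_derive 0 x sg.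
have d := @is_deriveM _ _ _ _ _ _ _ _ df dg.
rewrite (@derive_val _ _ _ _ _ _ _ d) /=.
by rewrite /GRing.scale /=; congr (_ + _); rewrite mulrC.
Qed.

(** Each differentiation of a product doubles the number of terms; counting
    them by [2 ^+ n] avoids binomial coefficients. *)
Lemma derive1nM_bound n f g x (A B : R) : smooth f -> smooth g ->
  (forall i, (i <= n)%N -> `|derive1n i f x| <= A) ->
  (forall i, (i <= n)%N -> `|derive1n i g x| <= B) ->
  `|derive1n n (fun x => f x * g x) x| <= 2 ^+ n * A * B.
Proof.
elim: n f g => [|n IH] f g sf sg bf bg.
  by rewrite expr0 mul1r /= normrM; apply: ler_pM => //; [exact: (bf 0%N)|exact: (bg 0%N)].
have sf' := smooth_deriv sf; have sg' := smooth_deriv sg.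
rewrite derive1Sn (derive1M sf sg) (derive1nD n (smoothM sf sg') (smoothM sf' sg)).
apply: (le_trans (ler_normD _ _)).
have -> : 2 ^+ n.+1 * A * B = 2 ^+ n * A * B + 2 ^+ n * A * B by rewrite exprS; ring.
apply: lerD.
- apply: (IH _ _ sf sg') => i le_in; first by apply: bf; rewrite ltnW.
  by rewrite -derive1Sn; exact: bg.
- apply: (IH _ _ sf' sg) => i le_in; last by apply: bg; rewrite ltnW.
  by rewrite -derive1Sn; exact: bf.
Qed.

End SmoothFunctions.

(** * A smooth step *)

Section SmoothStep.
Context {R : realType}.
Implicit Types (p : {poly R}) (x y : R).

(** The monomial of degree [n] is beaten by the exponential since the power
    series of the latter contains [y ^+ n / n`!]. *)
Lemma poly_expRN_bounded p :
  exists2 C : R, 0 <= C & forall y, 0 <= y -> `|p.[y]| * expR (- y) <= C.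
Proof.
exists (\sum_(i < size p) `|p`_i| * (i`!)%:R).
  by apply: sumr_ge0 => i _; exact: mulr_ge0.
move=> y y0; rewrite horner_coef.
apply: (@le_trans _ _ ((\sum_(i < size p) `|p`_i * y ^+ i|) * expR (- y))).
  by rewrite ler_wpM2r ?expR_ge0//; exact: ler_norm_sum.
rewrite mulr_suml; apply: ler_sum => i _.
rewrite normrM -mulrA ler_wpM2l// expRN ler_pdivrMr ?expR_gt0//.
rewrite ger0_norm ?exprn_ge0//.
case: (nat_of_ord i) => [|n].
  by rewrite expr0 fact0 mul1r; apply: le_trans (expR_ge1Dx _); rewrite lerDl.
rewrite mulrC -ler_pdivrMr ?ltr0n ?fact_gt0//.
apply: le_trans (expR_ge1Dxn n y0); by rewrite lerDr.
Qed.

(** The function [p(1/x) exp(-1/x)] continued by 0.  Letting [p] vary makes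
    the family closed under differentiation, so that all its members are
    smooth. *)
Definition flat p x := if 0 < x then p.[x^-1] * expR (- x^-1) else 0.

Lemma flat_bounded p : exists2 C : R, 0 <= C & forall x, `|flat p x| <= C.
Proof.
have [C C0 HC] := poly_expRN_bounded p; exists C => // x; rewrite /flat.
case: ifPn => [x0|_]; last by rewrite normr0.
by rewrite normrM (ger0_norm (expR_ge0 _)); apply: HC; rewrite invr_ge0 ltW.
Qed.

(** This factorisation shows continuity at 0, and it also identifies the
    difference quotient at 0 as a function of the same family. *)
Lemma flatXM p x : flat p x = x * flat ('X * p) x.
Proof.
rewrite /flat; case: ifPn => [x0|_]; last by rewrite mulr0.
by rewrite hornerM hornerX !mulrA divff ?mul1r// gt_eqF.
Qed.

Lemma flat_cvg0 p : flat p x @[x --> (0 : R)] --> 0.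
Proof.
have [C C0 HC] := flat_bounded ('X * p).
apply/cvgr0Pnorm_lt => e e0.
have d0 : 0 < e / (C + 1) by rewrite divr_gt0// ltr_wpDl.
near=> x.
rewrite flatXM normrM.
have xd : `|x| < e / (C + 1).
  by near: x; exact: (@nbhs0_lt _ R).
apply: (@le_lt_trans _ _ (`|x| * (C + 1))).
  by rewrite ler_wpM2l// (le_trans (HC x))// lerDl.
by rewrite -ltr_pdivlMr// ltr_wpDl.
Unshelve. all: by end_near. Qed.

Definition flat_deriv p : {poly R} := 'X^2 * (p - p^`()%R).

Lemma is_derive_flat p x : is_derive x 1 (flat p) (flat (flat_deriv p) x).
Proof.
have [x0|x0|->] := ltgtP x 0.
- have -> : flat (flat_deriv p) x = 0 by rewrite /flat ltNge (ltW x0).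
  apply: (@near_eq_is_derive R R R (cst 0) _ x 1 0 _ (is_derive_cst (0 : R) x 1)).
  have : \forall z \near x, z < 0 by exact: lt_nbhsl.
  by apply: filterS => z z0; rewrite /flat ltNge (ltW z0).
- have -> : flat (flat_deriv p) x = (flat_deriv p).[x^-1] * expR (- x^-1) by rewrite /flat x0.
  pose h : R -> R := (horner p * (expR \o -%R)) \o (fun z : R => z^-1).
  apply: (@near_eq_is_derive R R R h).
    have : \forall z \near x, 0 < z by exact: lt_nbhsr.
    by apply: filterS => z z0; rewrite /flat z0.
  have xn0 : x != 0 by rewrite gt_eqF.
  have dV := @is_deriveV _ id x 1 1 xn0 (is_derive_id x 1).
  have dN := @is_deriveN _ _ _ id x^-1 1 1 (is_derive_id _ _).
  have dE := @is_derive1_comp _ expR -%R x^-1 _ _ (is_derive_expR _) dN.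
  have dP := @is_deriveM _ _ _ _ _ _ _ _ (is_derive_poly p x^-1) dE.
  have dH := @is_derive1_comp _ _ (fun z => z^-1) x _ _ dP dV.
  refine (@is_derive_eq R R R h x 1 _ _ dH _).
  rewrite /flat_deriv !hornerE /GRing.scale /=.
  rewrite -!exprVn; ring.
- have f0 q : flat q 0 = 0 by rewrite /flat ltxx.
  rewrite f0.
  apply/is_derive1_caratheodory; exists (flat ('X * p)); split.
  + by move=> z; rewrite f0 !subr0 mulrC -flatXM.
  + suff : flat ('X * p) z @[z --> (0 : R)] --> flat ('X * p) 0 by [].
    by rewrite f0; exact: flat_cvg0.
  + exact: f0.
Qed.

Lemma smooth_flat p : smooth (flat p).
Proof.
apply: (@tower_smooth _ (fun n => flat (iter n flat_deriv p))) => n x.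
exact: is_derive_flat.
Qed.

Definition smooth_step x := flat 1 x / (flat 1 x + flat 1 (1 - x)).

Let flat1_ge0 x : 0 <= flat 1 x.
Proof. by rewrite /flat hornerC mul1r; case: ifP => // _; exact: expR_ge0. Qed.

Let flat1_gt0 x : 0 < x -> 0 < flat 1 x.
Proof. by move=> x0; rewrite /flat x0 hornerC mul1r expR_gt0. Qed.

Let denom_gt0 x : 0 < flat 1 x + flat 1 (1 - x).
Proof.
have [x0|x0] := ltP 0 x; first by rewrite ltr_pwDl ?flat1_gt0 ?flat1_ge0.
by rewrite ltr_wpDl ?flat1_ge0// flat1_gt0// subr_gt0 (le_lt_trans x0).
Qed.

Lemma smooth_smooth_step : smooth smooth_step.
Proof.
rewrite /smooth_step; apply: smoothM; first exact: smooth_flat.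
apply: smoothV; first by move=> x; rewrite gt_eqF.
apply: smoothD; first exact: smooth_flat.
rewrite (_ : (fun x => _) = fun x => flat 1 (-1 * x + 1)).
  by apply: smooth_affine; exact: smooth_flat.
by apply/funext => x; rewrite mulN1r addrC.
Qed.

Lemma smooth_step0 x : x <= 0 -> smooth_step x = 0.
Proof. by move=> x0; rewrite /smooth_step {1}/flat ltNge x0 mul0r. Qed.

Lemma smooth_step1 x : 1 <= x -> smooth_step x = 1.
Proof.
move=> x1; have := denom_gt0 x; rewrite /smooth_step [flat 1 (1 - x)]/flat.
have -> : (0 < 1 - x) = false by rewrite subr_gt0 ltNge x1.
by rewrite addr0 => h; rewrite divff// gt_eqF.
Qed.

End SmoothStep.

(** * Distributions with compact support *)

Section Distributions.
Context {R : realType}.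
Implicit Types (f g phi psi chi : R -> R) (K V : set R) (x a b : R).
Implicit Type mu : schwartz_distribution R.

Lemma smooth_continuous f k : smooth f -> continuous (derive1n k f).
Proof.
move=> sf x; apply: differentiable_continuous; apply/derivable1_diffP.
exact: sf.
Qed.

Lemma fun_supp_out f x : ~ fun_supp f x -> f x = 0.
Proof.
move=> nx; apply/eqP; apply/negPn/negP => fx; apply: nx.
exact: subset_closure.
Qed.

Lemma fun_supp_sub f K : closed K -> (forall x, ~ K x -> f x = 0) ->
  fun_supp f `<=` K.
Proof.
move=> cK f0; rewrite (closure_id K).1//; apply: closureS => x /=.
by apply: contra_neqP => /f0.
Qed.

Lemma fun_supp_itv f a b : (forall x, x < a -> f x = 0) ->
  (forall x, b < x -> f x = 0) -> fun_supp f `<=` `[a, b].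
Proof.
move=> fa fb; apply: fun_supp_sub; first exact: interval_closed.
move=> x /=; rewrite in_itv /=; have [xa|ax] := ltP x a; first by rewrite fa.
by have [//|bx] := leP x b; rewrite fb.
Qed.

Lemma test_function_itv f a b : smooth f -> fun_supp f `<=` `[a, b] ->
  test_function f.
Proof.
move=> sf ab; split=> //; apply: (subclosed_compact _ (@segment_compact _ a b)) => //.
exact: closed_closure.
Qed.

Lemma test_function_bounds f : test_function f ->
  exists M, forall x, M < `|x| -> f x = 0.
Proof.
move=> [_ /compact_bounded [M [_ HM]]]; exists (M + 1) => x Mx.
apply: fun_supp_out => fx.
have h : `|x| <= M + 1 by apply: (HM (M + 1)) => //; rewrite ltrDl.
by move: h; rewrite leNgt Mx.
Qed.

Lemma fun_suppMl f g : fun_supp (fun x => f x * g x) `<=` fun_supp f.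
Proof.
apply: fun_supp_sub; first exact: closed_closure.
by move=> x /fun_supp_out ->; rewrite mul0r.
Qed.

Lemma test_functionM f g : test_function f -> smooth g ->
  test_function (fun x => f x * g x).
Proof.
move=> [sf cf] sg; split; first exact: smoothM.
by apply: (subclosed_compact _ cf (fun_suppMl (g := g))); exact: closed_closure.
Qed.

Lemma test_function0 : test_function (fun _ : R => 0 : R).
Proof.
apply: (@test_function_itv _ 0 0); first exact: smooth_cst.
by apply: fun_supp_itv => x _.
Qed.

Lemma dist0 mu : mu (fun _ => 0) = 0.
Proof.
have := @dist_linear _ mu (-1) _ _ test_function0 test_function0.
rewrite (_ : (fun x => _) = fun=> 0); last by apply/funext => x; rewrite mulr0 addr0.
by rewrite mulN1r addNr.
Qed.

Lemma test_functionD f g : test_function f -> test_function g ->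
  test_function (fun x => f x + g x).
Proof.
move=> tf tg; have [M HM] := test_function_bounds tf.
have [N HN] := test_function_bounds tg.
have h x : Num.max M N < `|x| -> f x + g x = 0.
  by rewrite gt_max => /andP[xM xN]; rewrite HM// HN// addr0.
apply: (@test_function_itv _ (- `|Num.max M N|) `|Num.max M N|).
  by apply: smoothD; [case: tf|case: tg].
apply: fun_supp_itv => x hx; apply: h; apply: (le_lt_trans (ler_norm _)).
  by rewrite -(normrN x); apply: lt_le_trans (ler_norm _); rewrite ltrNr.
by apply: lt_le_trans (ler_norm _).
Qed.

Lemma dist_sum mu (I : Type) (s : seq I) (F : I -> R -> R) :
  (forall i, test_function (F i)) ->
  mu (fun x => \sum_(i <- s) F i x) = \sum_(i <- s) mu (F i).
Proof.
move=> tF; have tS t : test_function (fun x => \sum_(i <- t) F i x).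
  elim: t => [|i t IH].
    rewrite (_ : (fun x => _) = fun=> 0); first exact: test_function0.
    by apply/funext => x; rewrite big_nil.
  rewrite (_ : (fun x => _) = fun x => F i x + \sum_(j <- t) F j x).
    exact: test_functionD.
  by apply/funext => x; rewrite big_cons.
elim: s => [|i s IH].
  rewrite big_nil; transitivity (mu (fun _ => 0)); last exact: dist0.
  congr (mu _).
  by apply/funext => x; rewrite big_nil.
rewrite big_cons -IH -[mu (F i)]mul1r -dist_linear//; congr (mu _).
by apply/funext => x; rewrite big_cons mul1r.
Qed.

(** [Q] will be the property that a distribution vanishes on an open set. *)
Lemma lebesgue_number (K : set R) (Q : set R -> Prop) : compact K ->
  (forall x, K x -> exists2 V, open V /\ Q V & V x) ->
  exists2 e : R, 0 < e &
    forall x, K x -> exists2 V, Q V & forall y, `|x - y| < e -> V y.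
Proof.
move=> /compact_near_coveringP cK QK.
pose P (e : R) x := exists2 V, Q V & forall y, `|x - y| < e -> V y.
have : \forall e \near 0^'+, K `<=` P e.
  apply: cK => x Kx.
  have [V [oV QV] Vx] := QK x Kx.
  have /nbhs_ballP[r /= r0 rV] : nbhs x V by apply: open_nbhs_nbhs.
  exists (ball x (r / 2), [set e | e < r / 2]).
    split => /=; first by apply: nbhsx_ballx; rewrite divr_gt0.
    by apply: nbhs_right_lt; rewrite divr_gt0.
  move=> [y e] [/= xy er]; exists V => // z yz; apply: rV.
  rewrite /ball /= in xy *; rewrite -(subrKA y) [ltRHS](splitr r).
  by apply: (le_lt_trans (ler_normD _ _)); rewrite ltrD// (lt_trans yz).
move=> H; have [e [e0 He]] : exists e : R, 0 < e /\ K `<=` P e.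
  have : \forall e \near 0^'+, 0 < e /\ K `<=` P e.
    by near=> e; split; [near: e; exact: nbhs_right_gt | near: e].
  by move/filter_ex.
by exists e.
Unshelve. all: by end_near. Qed.

(** The support is defined by local vanishing, so this is a partition of
    unity argument.  On the line the translates of one smooth step telescope
    to 1; when the mesh is below a Lebesgue number of the cover, the
    difference of two consecutive translates cuts [psi] down to a piece
    lying in an open set on which [mu] vanishes. *)
Lemma dist_vanish mu psi : test_function psi ->
  (forall x, fun_supp psi x -> ~ dist_supp mu x) -> mu psi = 0.
Proof.
move=> tpsi disj.
have cov x : fun_supp psi x -> exists2 V, open V /\ vanishes_on mu V & V x.
  move=> /disj /contrapT[V VV Vx]; by exists V.
have [e e0 He] := lebesgue_number tpsi.2 cov.
have [M HM] := test_function_bounds tpsi.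
pose d := e / 4; have d0 : 0 < d by rewrite divr_gt0.
(* [J] translates of mesh [d] cover the interval that carries [psi]. *)
have [J HJ] : exists J : nat, 2 * `|M| / d + 1 <= J%:R.
  by exists (Num.truncn (2 * `|M| / d + 1)).+1; rewrite ltW// truncnS_gt.
pose h (j : nat) x := smooth_step ((x + `|M|) / d + 1 - j%:R).
have sh j : smooth (h j).
  rewrite /h (_ : (fun x => _) = fun x => smooth_step (d^-1 * x + (`|M| / d + 1 - j%:R))).
    by apply: smooth_affine; exact: smooth_smooth_step.
  by apply/funext => x; congr smooth_step; rewrite mulrDl; ring.
pose F (j : nat) x := psi x * (h j x - h j.+1 x).
have tF j : test_function (F j).
  apply: test_functionM => //.
  rewrite (_ : (fun x => _) = fun x => h j x + (-1) * h j.+1 x).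
    by apply: smoothD => //; exact: smoothZ.
  by apply/funext => x; rewrite mulN1r.
have psiE : psi = (fun x => \sum_(j <- iota 0 J) F j x).
  apply/funext => x; rewrite -mulr_sumr.
  have [xM|/HM ->] := leP `|x| M; last by rewrite mul0r.
  rewrite -[LHS]mulr1; congr (_ * _).
  transitivity (- \sum_(0 <= j < J) (h j.+1 x - h j x)); last first.
    by rewrite -sumrN /index_iota subn0; apply: eq_bigr => j _; rewrite opprB.
  have MM : `|M| = M by rewrite ger0_norm// (le_trans _ xM).
  move: xM; rewrite ler_norml => /andP[xM1 xM2].
  rewrite telescope_sumr// opprB {1}/h smooth_step1; last first.
    by rewrite subr0 lerDr; apply: divr_ge0; [rewrite MM -lerBlDr sub0r|exact: ltW].
  rewrite /h smooth_step0 ?subr0// subr_le0 (le_trans _ HJ)// lerD2r.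
  by rewrite ler_pM2r ?invr_gt0// mulrDl mul1r lerD// MM.
rewrite psiE (dist_sum _ _ tF) big1 // => j _.
have [[x Fx]|nF] := pselect (exists x, fun_supp (F j) x); last first.
  transitivity (mu (fun _ => 0)); last exact: dist0.
  congr (mu _); apply/funext => x; apply: fun_supp_out => Fx.
  by apply: nF; exists x.
have [V VV HV] := He x (fun_suppMl Fx).
apply: VV => //.
pose lo := ((j%:R - 1) * d - `|M|); pose hi := ((j%:R + 1) * d - `|M|).
have sub : fun_supp (F j) `<=` `[lo, hi].
  apply: fun_supp_itv => y hy; rewrite /F /h.
    have hw : (y + `|M|) / d < j%:R - 1 by rewrite ltr_pdivrMr// -ltrBrDr.
    by rewrite !smooth_step0 ?subrr ?mulr0// -?natr1; lra.
  have hw : j%:R + 1 < (y + `|M|) / d by rewrite ltr_pdivlMr// -ltrBlDr.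
  by rewrite !smooth_step1 ?subrr ?mulr0// -?natr1; lra.
move=> y Fy; apply: HV.
have := sub _ Fx; have := sub _ Fy; rewrite /= !in_itv /= /lo /hi.
have := d0; have de : e = 4 * d by rewrite /d mulrCA divff ?mulr1.
rewrite de ltr_norml => ? /andP[? ?] /andP[? ?]; apply/andP; split; lra.
Qed.

(** The support of the cutoff starts at any prescribed point below the
    support of [mu], which is what confines [pairing_estimate] to the right
    of that point. *)
Lemma exists_cutoff mu a b : compact (dist_supp mu) ->
  dist_supp mu `<=` `[b, +oo[ -> a < b ->
  exists (K : R) chi, [/\ a <= K, is_cutoff mu chi & fun_supp chi `<=` `[a, K] ].
Proof.
move=> /compact_bounded [M [_ HM]] sb ab.
(* Any plateau end beyond [|M| + 1] would do; [|a|] makes [a <= K]. *)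
pose K := `|M| + `|a| + 3; pose m := (a + b) / 2.
have am : 0 < m - a by rewrite /m; lra.
pose chi x := smooth_step ((x - a) / (m - a)) * smooth_step (K - x).
have schi : smooth chi.
  rewrite /chi (_ : (fun x => _) = fun x =>
    smooth_step ((m - a)^-1 * x + (- a / (m - a))) * smooth_step (-1 * x + K)).
    by apply: smoothM; apply: smooth_affine; exact: smooth_smooth_step.
  apply/funext => x; congr (smooth_step _ * smooth_step _); first by rewrite mulrDl mulrC.
  by rewrite mulN1r addrC.
have supp : fun_supp chi `<=` `[a, K].
  apply: fun_supp_itv => x hx; rewrite /chi.
    by rewrite smooth_step0 ?mul0r// pmulr_lle0 ?invr_gt0// subr_le0 ltW.
  by rewrite [X in _ * X]smooth_step0 ?mulr0// subr_le0 ltW.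
exists K, chi; split => //; first by rewrite /K; have := ler_norm a; have := normr_ge0 M; lra.
split; first exact: test_function_itv supp.
exists `]m, (`|M| + 2)[%classic.
  split; first exact: interval_open.
  move=> x Dx /=; rewrite in_itv /=.
  have := sb x Dx; rewrite /= in_itv /= andbT => bx.
  have hM : `|x| <= `|M| + 1.
    by apply: (HM (`|M| + 1)) => //; apply: (le_lt_trans (ler_norm M)); rewrite ltrDl.
  have := ler_norm x; rewrite /m => ?; apply/andP; split; lra.
move=> x /=; rewrite in_itv /= => /andP[mx xM].
have := normr_ge0 a => ?.
by rewrite /chi !smooth_step1 ?mulr1// /K ?ler_pdivlMr//; lra.
Qed.

Lemma derive1n_zero_on f V k : open V -> (forall x, V x -> f x = 0) ->
  forall x, V x -> derive1n k f x = 0.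
Proof.
move=> oV; elim: k f => [//|k IH] f f0 x Vx.
rewrite derive1Sn; apply: IH => // y Vy; rewrite derive1E.
have d : is_derive y 1 f 0.
  apply: (@near_eq_is_derive R R R (cst 0) _ y 1 0 _ (is_derive_cst (0 : R) y 1)).
  have : nbhs y V by apply: open_nbhs_nbhs.
  by apply: filterS => z Vz; rewrite f0.
exact: (@derive_val _ _ _ _ _ _ _ d).
Qed.

Lemma test_function_deriv_bounded f m : test_function f ->
  exists2 A : R, 0 <= A & forall k x, (k <= m)%N -> `|derive1n k f x| <= A.
Proof.
move=> tf; have [M HM] := test_function_bounds tf.
suff H k : exists2 A : R, 0 <= A & forall x, `|derive1n k f x| <= A.
  elim: m => [|m [A A0 HA]].
    have [A A0 HA] := H 0%N; exists A => // k x; rewrite leqn0 => /eqP ->; exact: HA.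
  have [B B0 HB] := H m.+1; exists (A + B); first exact: addr_ge0.
  move=> k x; rewrite leq_eqVlt => /orP[/eqP ->|km].
    by apply: le_trans (HB x) _; rewrite lerDr.
  by apply: le_trans (HA k x _) _; rewrite ?lerDl.
pose N := `|M| + 1.
have NN : - N <= N by rewrite /N; have := normr_ge0 M; lra.
have ctn : {within `[- N, N], continuous (fun x => `|derive1n k f x|)}.
  apply: continuous_subspaceT => x.
  apply: (@continuous_comp _ _ _ (derive1n k f) (fun y : R => `|y|)).
    exact: (smooth_continuous tf.1).
  exact: norm_continuous.
have [c cN Hc] := EVT_max NN ctn.
exists `|derive1n k f c| => // x.
have [xN|Nx] := boolP (x \in `[- N, N]); first exact: Hc.
rewrite (@derive1n_zero_on _ (~` `[- N, N]) k) ?normr0//.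
- by apply: closed_openC; exact: interval_closed.
- move=> y /= /negP yN; apply: HM; rewrite ltNge; apply: contra yN => yM.
  move: (le_trans yM (ler_norm M)); rewrite ler_norml in_itv /= /N => /andP[? ?].
  by apply/andP; split; lra.
- exact/negP.
Qed.

Lemma sup_norm_le f A : (forall x, `|f x| <= A) -> sup_norm f <= A.
Proof.
move=> fA; apply: ge_sup; first by exists `|f 0|, 0.
by move=> _ [x _ <-].
Qed.

Lemma cutoffP mu b : compact (dist_supp mu) ->
  dist_supp mu `<=` `[b, +oo[ -> is_cutoff mu (cutoff mu).
Proof.
move=> cs sb; apply: getPex.
have [|K [chi [_ H _]]] := exists_cutoff (a := b - 1) cs sb; first by rewrite ltrBlDr ltrDl.
by exists chi.
Qed.

(** The finite-order estimate of [mu], carried over to smooth functions by a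
    cutoff.  The freedom in [a] is used in [U_decay], where the kernel is
    small only on a half-line. *)
Lemma pairing_estimate mu a b : compact (dist_supp mu) ->
  dist_supp mu `<=` `[b, +oo[ -> a < b ->
  exists (C K : R) m, 0 <= C /\ forall phi e, smooth phi ->
    (forall i x, (i <= m)%N -> x \in `[a, K] -> `|derive1n i phi x| <= e) ->
    `|pairing mu phi| <= C * e.
Proof.
move=> cs sb ab; have [K [chi [aK cchi schi]]] := exists_cutoff cs sb ab.
have c0 := cutoffP cs sb.
have [C0 [m HC]] := dist_continuous mu (@segment_compact _ a K).
have [A A0 HA] := test_function_deriv_bounded m cchi.1.
exists (`|C0| * \sum_(k < m.+1) (2 ^+ k * A)), K, m; split.
  by apply: mulr_ge0 => //; apply: sumr_ge0 => k _; rewrite mulr_ge0// exprn_ge0.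
move=> phi e sphi He.
have pE : pairing mu phi = mu (fun x => chi x * phi x).
  have t1 := test_functionM cchi.1 sphi.
  have t2 : test_function (fun x => cutoff mu x + -1 * chi x).
    apply: test_functionD; first exact: c0.1.
    rewrite (_ : (fun x => _) = fun x => chi x * -1).
      by apply: test_functionM; [exact: cchi.1|exact: smooth_cst].
    by apply/funext => x; rewrite mulrC.
  have t3 := test_functionM t2 sphi.
  have z : mu (fun x => (cutoff mu x + -1 * chi x) * phi x) = 0.
    apply: dist_vanish => // x sx Dx.
    have [V1 [oV1 D1] H1] := c0.2; have [V2 [oV2 D2] H2] := cchi.2.
    suff H : (~` (V1 `&` V2)) x by apply: H; split; [exact: D1|exact: D2].
    apply: fun_supp_sub sx; first by apply: open_closedC; exact: openI.
    move=> y /contrapT[V1y V2y].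
    by rewrite H1// H2// mulr1 subrr mul0r.
  rewrite -[RHS]add0r -z -[X in X + _]mul1r -dist_linear//.
  rewrite /pairing; congr (mu _); apply/funext => x; ring.
have supp : fun_supp (fun x => chi x * phi x) `<=` `[a, K].
  by apply: subset_trans schi; exact: fun_suppMl.
rewrite pE; apply: (le_trans (HC _ _ supp)).
  exact: test_functionM cchi.1 sphi.
have s0 : 0 <= \sum_(k < m.+1) sup_norm (derive1n k (fun x => chi x * phi x)).
  apply: sumr_ge0 => k _; apply: le_trans (normr_ge0 _) _; last first.
    apply: ub_le_sup; last by exists 0.
    have [B B0 HB] := test_function_deriv_bounded k (test_functionM cchi.1 sphi).
    by exists B => _ [x _ <-]; exact: HB.
apply: (le_trans (ler_wpM2r s0 (ler_norm C0))).
rewrite -mulrA ler_wpM2l// mulr_suml; apply: ler_sum => k _.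
apply: sup_norm_le => x.
have e0 : 0 <= e.
  apply: le_trans (normr_ge0 _) (He 0%N a _ _) => //.
  by rewrite in_itv /= lexx.
have [xK|xK] := boolP (x \in `[a, K]).
  apply: (@derive1nM_bound _ k chi phi x A e cchi.1.1 sphi) => i ik.
    by apply: HA; rewrite (leq_trans ik)// -ltnS.
  by apply: He => //; rewrite (leq_trans ik)// -ltnS.
rewrite (@derive1n_zero_on _ (~` `[a, K]) k) ?normr0//.
- by rewrite !mulr_ge0// exprn_ge0.
- by apply: closed_openC; exact: interval_closed.
- move=> y yK; apply: (@fun_supp_out (fun z => chi z * phi z)) => sy.
  by apply: yK; exact: supp.
- exact/negP.
Qed.

Lemma pairing_linear mu b (c : R) phi psi : compact (dist_supp mu) ->
  dist_supp mu `<=` `[b, +oo[ -> smooth phi -> smooth psi ->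
  pairing mu (fun x => c * phi x + psi x) = c * pairing mu phi + pairing mu psi.
Proof.
move=> cs sb sphi spsi; have [tc _] := cutoffP cs sb.
rewrite -[RHS]dist_linear; [|exact: test_functionM..].
by rewrite /pairing; congr (mu _); apply/funext => x; ring.
Qed.

End Distributions.

(** * The normal distribution function *)

Section NormalCdf.
Context {R : realType}.
Implicit Types (s x y : R).

Let idRV : measurableTypeR R -> R := idfun.

#[local] HB.instance Definition _ :=
  @isMeasurableFun.Build _ _ _ _ idRV (@measurable_id _ _ setT).

Definition ncdf s x : R := fine (normal_prob 0 s `]-oo, x]).

Lemma is_derive_ncdf s x : s != 0 -> is_derive x 1 (ncdf s) (normal_pdf 0 s x).
Proof.
move=> s0.
have H := @continuous_FTC1 R (normal_pdf 0 s) -oo%O x (x + 1).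
have [] := H _ _ _ _.
- by rewrite ltrDl.
- by apply: integrableS (integrable_normal_pdf 0 s).
- by rewrite ltNyr.
- exact: continuous_normal_pdf.
by move=> d e; split => //; rewrite -e derive1E.
Qed.

Lemma ncdf_ge0 s x : 0 <= ncdf s x.
Proof. exact: fine_ge0. Qed.

Lemma ncdf_le1 s x : ncdf s x <= 1.
Proof. by rewrite -lee_fin fineK ?fin_num_measure// probability_le1. Qed.

Lemma ncdf_cvgNy s : ncdf s x @[x --> -oo] --> (0 : R).
Proof.
have := @cvg_cdfNy0 _ _ _ (normal_prob 0 s) (idRV : {RV normal_prob 0 s >-> R}).
by move/fine_cvg.
Qed.

Lemma ncdf_cvgy s : ncdf s x @[x --> +oo] --> (1 : R).
Proof.
have := @cvg_cdfy1 _ _ _ (normal_prob 0 s) (idRV : {RV normal_prob 0 s >-> R}).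
by move/fine_cvg.
Qed.

Lemma normal_pdf01 x :
  normal_pdf 0 1 x = (Num.sqrt (2 * pi))^-1 * expR (- (x ^+ 2) / 2).
Proof.
rewrite normal_pdfE ?oner_neq0// /normal_peak /normal_fun subr0 expr1n mul1r.
by rewrite -mulr_natl.
Qed.

Lemma normal_cdfE x : normal_cdf x = ncdf 1 x.
Proof.
transitivity (\int[lebesgue_measure]_(t in `]-oo, x]) normal_pdf 0 1 t) => //.
rewrite /normal_cdf -RintegralZl//; last first.
  have c0 : (Num.sqrt (2 * pi))^-1 != 0 :> R.
    by rewrite invr_eq0 gt_eqF// sqrtr_gt0 mulr_gt0// pi_gt0.
  apply: (@integrableS _ _ R lebesgue_measure setT) => //.
  have I1 := integrableZl measurableT (Num.sqrt (2 * pi)) (@integrable_normal_pdf R 0 1).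
  apply: (eq_integrable measurableT _ _ _ I1) => t _; rewrite -EFinM normal_pdf01 mulVKf//.
  by rewrite invr_eq0 in c0.
by apply: eq_Rintegral => t _; rewrite normal_pdf01.
Qed.

Lemma normal_pdf_scale s x : 0 < s -> normal_pdf 0 s x = normal_pdf 0 1 (x / s) / s.
Proof.
move=> s0; rewrite normal_pdf01 normal_pdfE ?gt_eqF// /normal_peak /normal_fun.
rewrite subr0 [RHS]mulrAC; congr (_ * _); last first.
  congr expR; rewrite expr_div_n -mulr_natr; field.
  by rewrite gt_eqF.
rewrite -mulr_natr -mulrA sqrtrM ?sqr_ge0// sqrtr_sqr (gtr0_norm s0) invfM.
by rewrite mulrC (mulrC pi).
Qed.

Lemma is_derive_normal_cdf x : is_derive x 1 normal_cdf (normal_pdf 0 1 x).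
Proof.
have -> : normal_cdf = ncdf 1 :> (R -> R) by apply/funext => y; exact: normal_cdfE.
by apply: is_derive_ncdf; exact: oner_neq0.
Qed.

Lemma normal_cdf_ge0 x : 0 <= normal_cdf x.
Proof. by rewrite normal_cdfE ncdf_ge0. Qed.

Lemma normal_cdf_le1 x : normal_cdf x <= 1.
Proof. by rewrite normal_cdfE ncdf_le1. Qed.

Lemma normal_cdf_cvgNy : normal_cdf x @[x --> -oo] --> (0 : R).
Proof.
have -> : normal_cdf = ncdf 1 :> (R -> R) by apply/funext => y; exact: normal_cdfE.
exact: ncdf_cvgNy.
Qed.

Lemma normal_cdf_cvgy : normal_cdf x @[x --> +oo] --> (1 : R).
Proof.
have -> : normal_cdf = ncdf 1 :> (R -> R) by apply/funext => y; exact: normal_cdfE.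
exact: ncdf_cvgy.
Qed.

(** Identities between distribution functions are checked on densities; the
    constant left by integration is read off at -oo. *)
Lemma derive0_limNy (f : R -> R) (l : R) : (forall x, is_derive x 1 f 0) ->
  f x @[x --> -oo] --> l -> forall x, f x = l.
Proof.
move=> df fl x.
have -> : f = cst (f x) by apply/funext => y; exact: is_derive_0_is_cst.
have fl' : f y @[y --> -oo] --> f x.
  rewrite (_ : f = cst (f x)); first exact: cvg_cst.
  by apply/funext => y; exact: is_derive_0_is_cst.
exact: (cvg_unique _ fl' fl).
Qed.

Lemma is_derive_mulr (f : R -> R) (a b x df : R) : is_derive (a * x + b) 1 f df ->
  is_derive x 1 (fun z => f (a * z + b)) (df * a).
Proof.
move=> Df.
have dh : is_derive x 1 (fun x => a * x + b : R) (a *: 1 + 0).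
  exact: (@is_deriveD _ _ _ (a *: @id R) (cst b) x 1 (a *: 1) 0
    (@is_deriveZ _ _ _ (@id R) a x 1 1 (is_derive_id x 1)) (is_derive_cst b x 1)).
have dc := @is_derive1_comp _ f (fun x => a * x + b) x _ _ Df dh.
apply: (@is_derive_eq _ _ _ _ _ _ _ _ dc).
by rewrite addr0 /GRing.scale /= mulr1.
Qed.

Lemma ncdf_scale s x : 0 < s -> ncdf s x = normal_cdf (x / s).
Proof.
move=> s0; apply/eqP; rewrite -subr_eq0; apply/eqP; move: x.
apply: (@derive0_limNy (fun x => ncdf s x - normal_cdf (x / s))) => [x|].
  have d1 := @is_derive_ncdf s x (lt0r_neq0 s0).
  have d2 := @is_derive_mulr normal_cdf s^-1 0 x _ (is_derive_normal_cdf _).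
  rewrite (_ : (fun x => _) = (fun x => ncdf s x - normal_cdf (s^-1 * x + 0))); last first.
    by apply/funext => y; rewrite addr0 mulrC.
  apply: (@is_derive_eq _ _ _ _ _ _ _ _ (@is_deriveB _ _ _ _ _ _ _ _ _ d1 d2)).
  by rewrite normal_pdf_scale// addr0 (mulrC x) subrr.
rewrite -[X in _ --> X](subrr 0); apply: cvgB; first exact: ncdf_cvgNy.
apply: (cvg_comp (fun x => x / s) normal_cdf); last exact: normal_cdf_cvgNy.
by apply: gt0_cvgMlNy; rewrite ?invr_gt0.
Qed.

Lemma normal_cdfN x : normal_cdf (- x) = 1 - normal_cdf x.
Proof.
suff : normal_cdf x + normal_cdf (- x) = 1 by move=> <-; rewrite addrAC subrr add0r.
move: x; apply: (@derive0_limNy (fun x => normal_cdf x + normal_cdf (- x))) => [x|].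
  have d1 := is_derive_normal_cdf x.
  have d2 := @is_derive_mulr normal_cdf (-1) 0 x _ (is_derive_normal_cdf _).
  rewrite (_ : (fun x => _) = (fun x => normal_cdf x + normal_cdf (-1 * x + 0))); last first.
    by apply/funext => y; rewrite addr0 mulN1r.
  apply: (@is_derive_eq _ _ _ _ _ _ _ _ (@is_deriveD _ _ _ _ _ _ _ _ _ d1 d2)).
  by rewrite !normal_pdf01 addr0 mulN1r sqrrN mulrN1 subrr.
rewrite -[X in _ --> X]add0r; apply: cvgD; first exact: normal_cdf_cvgNy.
apply: (cvg_comp -%R normal_cdf); last exact: normal_cdf_cvgy.
by rewrite cvgNry; exact: cvg_id.
Qed.
End NormalCdf.

(** * The heat kernel and its derivatives *)

Section HeatKernel.
Context {R : realType}.
Implicit Types (s x y z w v : R) (k i : nat).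

(** The Hermite polynomials, up to sign and to the factor [(2 pi)^(-1/2)]. *)
Fixpoint gauss_poly k : {poly R} :=
  if k is j.+1 then ((gauss_poly j)^`() - 'X * gauss_poly j)%R
  else ((Num.sqrt (2 * pi))^-1)%:P.

Definition ncdf_deriv k z : R :=
  if k is j.+1 then (gauss_poly j).[z] * expR (- (z ^+ 2) / 2)
  else normal_cdf z.

Lemma tower_ncdf : tower ncdf_deriv.
Proof.
move=> [|k] z.
  apply: (@is_derive_eq _ _ _ _ _ _ _ _ (is_derive_normal_cdf z)).
  by rewrite normal_pdf01 /= hornerC.
have dX := @is_derive_poly _ ((- (2^-1))%:P * 'X^2 : {poly R}) z.
have dE := @is_derive1_comp _ expR _ z _ _ (is_derive_expR _) dX.
have dM := @is_deriveM _ _ _ _ _ _ _ _ (is_derive_poly (gauss_poly k) z) dE.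
have eqE y : ((- (2^-1))%:P * 'X^2 : {poly R}).[y] = - (y ^+ 2) / 2.
  by rewrite hornerM hornerC hornerXn mulrC mulrN mulNr.
have -> : ncdf_deriv k.+1 = horner (gauss_poly k) *
    (expR \o horner ((- (2^-1))%:P * 'X^2 : {poly R})) :> (R -> R).
  by apply/funext => y; rewrite /= !fctE /= eqE.
apply: (@is_derive_eq _ _ _ _ _ _ _ _ dM).
rewrite /= !eqE derivM derivC mul0r add0r derivXn !hornerE /GRing.scale /=.
rewrite ?(hornerXn, hornerE).
set A := (gauss_poly k).[z]; set B := (_)^`().[z]; set E := expR _.
transitivity (A * E * - 2^-1 * (z + z) + E * B); first by [].
by field.
Qed.

(** From [(|z| - 1)^2 >= 0]: the Gaussian inherits the bounds known for the
    exponential. *)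
Lemma expR_sqr_le z : expR (- (z ^+ 2) / 2) <= expR 2^-1 * expR (- `|z|).
Proof.
rewrite -expRD ler_expR.
have := sqr_ge0 (`|z| - 1); have := real_normK (num_real z) => <-.
by rewrite sqrrB1 -mulr_natr; lra.
Qed.

Lemma poly_gauss_bounded (p : {poly R}) :
  exists2 C : R, 0 <= C & forall z, `|p.[z] * expR (- (z ^+ 2) / 2)| <= C.
Proof.
have [C1 C10 H1] := poly_expRN_bounded p.
have [C2 C20 H2] := poly_expRN_bounded (p \Po (- 'X)).
exists (expR 2^-1 * (C1 + C2)) => [|z].
  by rewrite mulr_ge0 ?expR_ge0 ?addr_ge0.
rewrite normrM (ger0_norm (expR_ge0 _)).
apply: (le_trans (ler_wpM2l (normr_ge0 _) (expR_sqr_le z))).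
rewrite mulrCA ler_wpM2l ?expR_ge0//.
have [z0|z0] := leP 0 z.
  by rewrite (ger0_norm z0); apply: le_trans (H1 _ z0) _; rewrite lerDl.
have := H2 (- z); rewrite horner_comp hornerN hornerX opprK (ltr0_norm z0) opprK => H.
by apply: le_trans (H _) _; rewrite ?lerDr// oppr_ge0 ltW.
Qed.

Lemma ncdf_deriv_bounded k : exists2 C : R, 0 <= C & forall z, `|ncdf_deriv k z| <= C.
Proof.
case: k => [|k]; last exact: poly_gauss_bounded.
exists 1 => // z; rewrite /= ger0_norm ?normal_cdf_ge0//; exact: normal_cdf_le1.
Qed.

(** The factor [z ^+ k] pays for the power of [s^-1] produced by
    differentiating [k] times at scale [s], see [heat_decay]. *)
Lemma ncdf_deriv_decay k : z ^+ k * ncdf_deriv k z @[z --> -oo] --> (0 : R).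
Proof.
case: k => [|k].
  by under eq_fun do rewrite expr0 mul1r; exact: normal_cdf_cvgNy.
have [C C0 HC] := poly_gauss_bounded ('X^(k.+2) * gauss_poly k).
apply/cvgr0Pnorm_lt => e e0.
near=> z.
have z0 : z < 0 by near: z; apply: nbhs_ninfty_lt; rewrite num_real.
have zC : z < - (C / e) by near: z; apply: nbhs_ninfty_lt; rewrite num_real.
have nz : 0 < `|z| by rewrite normr_gt0 lt_eqF.
rewrite -(ltr_pM2l nz) -normrM; apply: le_lt_trans (_ : C < _).
  apply: le_trans (HC z); rewrite hornerM hornerXn (exprS z k.+1) -!mulrA.
  exact: lexx.
by rewrite ltr0_norm// -ltr_pdivrMr// ltrNr.
Unshelve. all: by end_near. Qed.

(** The [k]-th derivative of [w |-> N(w / s)].  With [s = sqrt (T - t)], the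
    integrand of U(x, t) is [v |-> heat s 0 (x - v)]. *)
Definition heat s k w := (s^-1) ^+ k * ncdf_deriv k (w / s).

(** The chain rule contributes one factor [s^-1] at each step. *)
Lemma tower_heat s : tower (heat s).
Proof.
move=> k w.
have d := @is_derive_mulr _ (ncdf_deriv k) s^-1 0 w _ (tower_ncdf _ _).
have dZ := @is_deriveZ _ _ _ _ ((s^-1) ^+ k) _ _ _ d.
have -> : heat s k = (s^-1 ^+ k) *: (fun z => ncdf_deriv k (s^-1 * z + 0)).
  by apply/funext => y; rewrite fctE /heat addr0 [y / s]mulrC.
apply: (@is_derive_eq _ _ _ _ _ _ _ _ dZ).
by rewrite /heat addr0 exprS (mulrC w) /GRing.scale /=; ring.
Qed.

Lemma tower_refl (F : nat -> R -> R) x : tower F ->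
  tower (fun k v => (-1) ^+ k * F k (x - v)).
Proof.
move=> tF k v.
have d := @is_derive_mulr _ (F k) (-1) x v _ (tF _ _).
have dZ := @is_deriveZ _ _ _ _ ((-1) ^+ k) _ _ _ d.
have -> : (fun v => (-1) ^+ k * F k (x - v)) = ((-1) ^+ k) *: (fun z => F k (-1 * z + x)).
  by apply/funext => y; rewrite fctE mulN1r addrC.
apply: (@is_derive_eq _ _ _ _ _ _ _ _ dZ).
by rewrite mulN1r (addrC (- v)) exprS /GRing.scale /=; ring.
Qed.

Lemma heat_bounded s0 m : 0 < s0 -> exists2 C : R, 0 <= C &
  forall s k w, s0 <= s -> (k <= m)%N -> `|heat s k w| <= C.
Proof.
move=> s00.
suff H k : exists2 C : R, 0 <= C & forall s w, s0 <= s -> `|heat s k w| <= C.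
  elim: m => [|m [A A0 HA]].
    have [A A0 HA] := H 0%N; exists A => // s k w ?; rewrite leqn0 => /eqP ->; exact: HA.
  have [B B0 HB] := H m.+1; exists (A + B); first exact: addr_ge0.
  move=> s k w ss; rewrite leq_eqVlt => /orP[/eqP ->|km].
    by apply: le_trans (HB _ _ ss) _; rewrite lerDr.
  by apply: le_trans (HA _ _ _ ss km) _; rewrite ?lerDl.
have [C C0 HC] := ncdf_deriv_bounded k.
exists ((s0^-1) ^+ k * C) => [|s w ss].
  by rewrite mulr_ge0// exprn_ge0// invr_ge0 (ltW s00).
have sp : 0 < s by exact: lt_le_trans ss.
rewrite /heat normrM ger0_norm ?exprn_ge0 ?invr_ge0 ?(ltW sp)//.
apply: ler_pM => //; first by rewrite exprn_ge0 ?invr_ge0 ?(ltW sp)//.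
apply: lerXn2r; rewrite ?nnegrE ?invr_ge0 ?(ltW sp) ?(ltW s00)//.
by rewrite lef_pV2 ?posrE.
Qed.

(** With [z = w / s], the bound [w <= - eta] gives [s^-1 <= |z| / eta], so
    that the [k]-th derivative is at most [|z ^+ k * ncdf_deriv k z| / eta
    ^+ k], and [z] tends to -oo. *)
Lemma heat_decay k (eta e : R) : 0 < eta -> 0 < e -> exists2 s0 : R, 0 < s0 &
  forall s w, 0 < s < s0 -> w <= - eta -> `|heat s k w| <= e.
Proof.
move=> eta0 e0.
have e'0 : 0 < e * eta ^+ k by rewrite mulr_gt0// exprn_gt0.
have /cvgr0Pnorm_lt /(_ _ e'0) [M [_ HM]] := ncdf_deriv_decay k.
pose M' := `|M| + 1; have M'0 : 0 < M' by rewrite ltr_wpDl.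
exists (eta / M') => [|s w /andP[s0 sM] weta]; first by rewrite divr_gt0.
have w0 : w < 0 by rewrite (le_lt_trans weta)// oppr_lt0.
have wM : w / s < M.
  apply: (@lt_le_trans _ _ (- M')); last first.
    by have := ler_norm (- M); rewrite normrN /M'; lra.
  by rewrite ltr_pdivrMr// mulNr (le_lt_trans weta)// ltrN2 mulrC -ltr_pdivlMr.
have := HM _ wM; rewrite /= /heat => H.
rewrite normrM normrX -(@ler_pM2r _ (eta ^+ k)) ?exprn_gt0//.
apply: le_trans (ltW H); rewrite normrM normrX mulrAC ler_wpM2r//.
rewrite -exprMn; apply: lerXn2r; rewrite ?nnegrE ?mulr_ge0 ?(ltW eta0)//.
by rewrite normrM mulrC ler_wpM2r// (ltr0_norm w0) lerNr.
Qed.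

Lemma bounded_deriv_lipschitz (f f' : R -> R) (C : R) :
  (forall x, is_derive x 1 f (f' x)) -> (forall x, `|f' x| <= C) ->
  forall x y, `|f x - f y| <= C * `|x - y|.
Proof.
move=> df fC x y.
wlog xy : x y / y <= x.
  move=> H; have [?|/ltW ?] := leP y x; first exact: H.
  by rewrite distrC (distrC x); exact: H.
have [|c _ ->] := MVT_segment xy (fun z _ => df z).
  apply: continuous_subspaceT => z; apply: differentiable_continuous.
  by apply/derivable1_diffP; case: (df z).
by rewrite normrM ler_wpM2r.
Qed.

Lemma cvg_heat (T : Type) (F : set_system T) (FF : Filter F) (s w : T -> R) s0 w0 k :
  s0 != 0 -> s x @[x --> F] --> s0 -> w x @[x --> F] --> w0 ->
  heat (s x) k (w x) @[x --> F] --> heat s0 k w0.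
Proof.
move=> s00 cs cw; rewrite /heat.
have cV : (s x)^-1 @[x --> F] --> s0^-1 by apply: cvgV.
apply: cvgM.
  elim: k => [|j IH]; first by under eq_fun do rewrite expr0; exact: cvg_cst.
  by under eq_fun do rewrite exprS; rewrite exprS; apply: cvgM.
have ck : {for w0 / s0, continuous (ncdf_deriv k)}.
  apply: differentiable_continuous; apply/derivable1_diffP.
  by case: (tower_ncdf k (w0 / s0)).
have cq : w x / s x @[x --> F] --> w0 / s0 by exact: cvgM.
exact: (continuous_cvg _ ck cq).
Qed.
End HeatKernel.

(** * Regularity of U *)

Section HeatExtension.
Context {R : realType}.
Variables (T b : R) (mu : schwartz_distribution R).
Hypothesis cmu : compact (dist_supp mu).
Hypothesis smu : dist_supp mu `<=` `[b, +oo[.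
Implicit Types (x y t v w s e : R).

Lemma heat_smooth s x : smooth (fun v : R => heat s 0 (x - v)).
Proof.
have := tower_smooth (tower_refl x (tower_heat s)).
by rewrite /= (_ : (fun v => _) = fun v => heat s 0 (x - v))//; apply/funext => v;
  rewrite mul1r.
Qed.

Lemma heat_derive1n s x k :
  derive1n k (fun v : R => heat s 0 (x - v)) = fun v => (-1) ^+ k * heat s k (x - v).
Proof.
have := tower_derive1n k (tower_refl x (tower_heat s)).
by rewrite (_ : (fun v => (-1) ^+ 0 * _) = fun v => heat s 0 (x - v))//; apply/funext => v;
  rewrite expr0 mul1r.
Qed.

Lemma UE x t : t < T ->
  U T x t mu = pairing mu (fun v => heat (Num.sqrt (T - t)) 0 (x - v)).
Proof.
move=> tT; rewrite /U tT; congr (pairing mu _); apply/funext => v.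
by rewrite /heat expr0 mul1r.
Qed.

Lemma pairingB phi psi : smooth phi -> smooth psi ->
  pairing mu (fun v => phi v - psi v) = pairing mu phi - pairing mu psi.
Proof.
move=> sphi spsi; rewrite addrC -mulN1r -(pairing_linear _ cmu smu)//.
by congr (pairing mu _); apply/funext => v; rewrite mulN1r addrC.
Qed.

Lemma pairing_heatB s x s' x' :
  pairing mu (fun v => heat s 0 (x - v)) - pairing mu (fun v => heat s' 0 (x' - v)) =
  pairing mu (fun v => heat s 0 (x - v) - heat s' 0 (x' - v)).
Proof. by rewrite (pairingB (@heat_smooth s x) (@heat_smooth s' x')). Qed.

Lemma derive1n_heatB s x s' x' k :
  derive1n k (fun v : R => heat s 0 (x - v) - heat s' 0 (x' - v)) =
  fun v => (-1) ^+ k * (heat s k (x - v) - heat s' k (x' - v)).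
Proof.
rewrite (_ : (fun v => _) = fun v => heat s 0 (x - v) + -1 * heat s' 0 (x' - v)); last first.
  by apply/funext => v; rewrite mulN1r.
have sx := @heat_smooth s x; have sx' := @heat_smooth s' x'.
rewrite (@derive1nD _ k _ _ sx (@smoothZ _ (-1) _ sx')) (@derive1nZ _ k (-1) _ sx').
by rewrite !heat_derive1n; apply/funext => v; ring.
Qed.

Lemma heatB_smooth s x s' x' :
  smooth (fun v : R => heat s 0 (x - v) - heat s' 0 (x' - v)).
Proof.
have := smoothD (@heat_smooth s x) (@smoothZ _ (-1) _ (@heat_smooth s' x')).
by congr smooth; apply/funext => v; rewrite mulN1r.
Qed.

Lemma normr_signM k x : `|(-1) ^+ k * x| = `|x|.
Proof. by rewrite normrM normrX normrN1 expr1n mul1r. Qed.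

(** Away from time [T] all derivatives of the kernel are bounded, uniformly
    in the position [x], which may lie above the boundary. *)
Lemma U_bounded s : s < T ->
  exists2 C : R, 0 <= C & forall x t, t <= s -> `|U T x t mu| <= C.
Proof.
move=> sT; have s0 : 0 < Num.sqrt (T - s) by rewrite sqrtr_gt0 subr_gt0.
have [|C [K [m [C0 HC]]]] := pairing_estimate (a := b - 1) cmu smu.
  by rewrite ltrBlDr ltrDl.
have [B B0 HB] := heat_bounded m s0.
exists (C * B) => [|x t ts]; first exact: mulr_ge0.
rewrite UE ?(le_lt_trans ts)//; apply: HC => [|i v im _]; first exact: heat_smooth.
rewrite heat_derive1n normr_signM; apply: HB => //.
by rewrite ler_wsqrtr// lerD2l lerN2.
Qed.

Lemma U_lipschitz t : t < T -> exists2 C : R, 0 <= C &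
  forall x y, `|U T x t mu - U T y t mu| <= C * `|x - y|.
Proof.
move=> tT; have s0 : 0 < Num.sqrt (T - t) by rewrite sqrtr_gt0 subr_gt0.
have [|C [K [m [C0 HC]]]] := pairing_estimate (a := b - 1) cmu smu.
  by rewrite ltrBlDr ltrDl.
have [B B0 HB] := heat_bounded m.+1 s0.
exists (C * B) => [|x y]; first exact: mulr_ge0.
rewrite !UE// pairing_heatB -mulrA; apply: HC => [|i v im _].
  exact: (@heatB_smooth (Num.sqrt (T - t)) x (Num.sqrt (T - t)) y).
rewrite derive1n_heatB normr_signM.
have -> : x - y = (x - v) - (y - v) by rewrite opprB addrA subrK.
apply: (bounded_deriv_lipschitz (tower_heat _ i)) => z.
exact: HB.
Qed.

(** With [a] halfway between [x] and [b], the argument [x' - v] of the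
    kernel stays below a negative constant for all [v >= a], and
    [heat_decay] applies to every derivative that enters the estimate. *)
Lemma U_decay x e : x < b -> 0 < e -> exists2 d : R, 0 < d &
  forall x' t, `|x' - x| < d -> T - d < t < T -> `|U T x' t mu| <= e.
Proof.
move=> xb e0; pose a := (x + b) / 2; pose eta := (b - x) / 4.
have eta0 : 0 < eta by rewrite /eta divr_gt0// subr_gt0.
have ab : a < b by rewrite /a; lra.
have [C [K [m [C0 HC]]]] := pairing_estimate cmu smu ab.
have e'0 : 0 < e / (C + 1) by rewrite divr_gt0// ltr_wpDl.
have [s0 s00 Hs] : exists2 s0 : R, 0 < s0 & forall s i w, (i <= m)%N ->
    0 < s < s0 -> w <= - eta -> `|heat s i w| <= e / (C + 1).
  clear HC; elim: m => [|m [s1 s10 H1]].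
    have [s0 s00 Hs] := heat_decay 0 eta0 e'0.
    by exists s0 => // s i w; rewrite leqn0 => /eqP ->; exact: Hs.
  have [s2 s20 H2] := heat_decay m.+1 eta0 e'0.
  exists (Num.min s1 s2) => [|s i w]; first by rewrite lt_min s10.
  rewrite leq_eqVlt lt_min => /orP[/eqP ->|im] /andP[sp /andP[ss1 ss2]] weta.
    by apply: H2; rewrite ?sp.
  by apply: H1; rewrite ?sp.
exists (Num.min eta (s0 ^+ 2)) => [|x' t]; first by rewrite lt_min eta0 exprn_gt0.
rewrite lt_min => /andP[x'x _] /andP[tT1 tT].
have {tT1} tT1 : T - t < s0 ^+ 2.
  by rewrite ltrBlDl -ltrBlDr; apply: le_lt_trans tT1; rewrite lerD2l lerN2 ge_min lexx orbT.
rewrite UE//; apply: (@le_trans _ _ (C * (e / (C + 1)))); last first.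
  rewrite mulrCA ler_piMr ?(ltW e0)// ler_pdivrMr ?mul1r ?lerDl//.
  by rewrite ltr_wpDl.
apply: HC => [|i v im vK]; first exact: heat_smooth.
rewrite heat_derive1n normr_signM; apply: Hs => //.
  rewrite sqrtr_gt0 subr_gt0 tT /= -(gtr0_norm s00) -sqrtr_sqr ltr_sqrt//.
  by rewrite exprn_gt0.
move: vK x'x; rewrite in_itv /= ltr_norml /eta /a => /andP[? _] /andP[_ ?]; lra.
Qed.

(** The kernel is jointly continuous in (x, t, v); compactness of the
    interval seen by [pairing_estimate] makes this uniform in [v]. *)
Lemma U_continuous x t : t < T ->
  {for (x, t), continuous (fun p : R * R => U T p.1 p.2 mu)}.
Proof.
move=> tT.
have [|C [K [m [C0 HC]]]] := pairing_estimate (a := b - 1) cmu smu.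
  by rewrite ltrBlDr ltrDl.
have T0 : Num.sqrt (T - t) != 0 by rewrite gt_eqF// sqrtr_gt0 subr_gt0.
have near2 : \forall p \near (x, t), p.2 < T.
  have : p.2 @[p --> (x, t)] --> t by exact: cvg_snd.
  by move/(_ [set z | z < T]); apply; exact: lt_nbhsl.
have Hi i e : 0 < e -> \forall p \near (x, t), forall v, v \in `[b - 1, K] ->
    `|heat (Num.sqrt (T - p.2)) i (p.1 - v) - heat (Num.sqrt (T - t)) i (x - v)| < e.
  move=> e0.
  have := @segment_compact R (b - 1) K => /compact_near_coveringP /(_ _ (nbhs (x, t))
    (fun p v => `|heat (Num.sqrt (T - p.2)) i (p.1 - v) -
      heat (Num.sqrt (T - t)) i (x - v)| < e) _).
  apply => v _.
  have c2 : p.1 @[p --> (x, t)] --> x by exact: cvg_fst.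
  have c3 : p.2 @[p --> (x, t)] --> t by exact: cvg_snd.
  have cq1 : q.1 @[q --> (v, (x, t))] --> v by exact: cvg_fst.
  have cq2 : q.2 @[q --> (v, (x, t))] --> (x, t) by exact: cvg_snd.
  have cq21 : q.2.1 @[q --> (v, (x, t))] --> x by exact: cvg_comp cq2 c2.
  have cq22 : q.2.2 @[q --> (v, (x, t))] --> t by exact: cvg_comp cq2 c3.
  have cs : Num.sqrt (T - q.2.2) @[q --> (v, (x, t))] --> Num.sqrt (T - t).
    apply: continuous_cvg; first exact: sqrt_continuous.
    by apply: cvgB => //; exact: cvg_cst.
  have H1 : heat (Num.sqrt (T - q.2.2)) i (q.2.1 - q.1) @[q --> (v, (x, t))] -->
      heat (Num.sqrt (T - t)) i (x - v).
    by apply: cvg_heat => //; exact: cvgB.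
  have H2 : heat (Num.sqrt (T - t)) i (x - q.1) @[q --> (v, (x, t))] -->
      heat (Num.sqrt (T - t)) i (x - v).
    by apply: cvg_heat => //; [exact: cvg_cst|apply: cvgB => //; exact: cvg_cst].
  have H3 := cvgB H1 H2; rewrite subrr in H3.
  have H4 := iffLR (cvgr0Pnorm_lt _) (H3 (nbhs_filter _)) e e0.
  exact: H4.
have Hm e : 0 < e -> \forall p \near (x, t), forall i v, (i <= m)%N -> v \in `[b - 1, K] ->
    `|heat (Num.sqrt (T - p.2)) i (p.1 - v) - heat (Num.sqrt (T - t)) i (x - v)| < e.
  move=> e0; clear HC; elim: m => [|m IH].
    by apply: filterS (Hi 0%N e e0) => p Hp i v; rewrite leqn0 => /eqP ->; exact: Hp.
  apply: filterS2 IH (Hi m.+1 e e0) => p Hp1 Hp2 i v.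
  by rewrite leq_eqVlt => /orP[/eqP ->|]; [exact: Hp2|exact: Hp1].
apply/cvgrPdist_le => e e0.
have e'0 : 0 < e / (C + 1) by rewrite divr_gt0// ltr_wpDl.
apply: filterS2 near2 (Hm _ e'0) => p pT Hp /=.
rewrite distrC !UE// pairing_heatB; apply: (@le_trans _ _ (C * (e / (C + 1)))); last first.
  rewrite mulrCA ler_piMr ?(ltW e0)// ler_pdivrMr ?mul1r ?lerDl//.
  by rewrite ltr_wpDl.
apply: HC => [|i v im vK].
  exact: (@heatB_smooth (Num.sqrt (T - p.2)) p.1 (Num.sqrt (T - t)) x).
by rewrite derive1n_heatB normr_signM ltW// Hp.
Qed.

End HeatExtension.

(** * Integrals against a probability, and quadrature *)

Section BoundedIntegrals.
Context {R : realType} d {Y : measurableType d} (P : probability Y R).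
Implicit Types (f : Y -> R) (D : set Y).

Lemma bounded_integrable D f (C : R) : measurable D -> measurable_fun D f ->
  (forall y, D y -> `|f y| <= C) -> P.-integrable D (EFin \o f).
Proof.
move=> mD mf fC; apply: measurable_bounded_integrable => //.
  by rewrite (le_lt_trans (probability_le1 P mD))// ltry.
exists C; split; first exact: num_real.
by move=> M CM y Dy; exact: le_trans (fC y Dy) (ltW CM).
Qed.

Lemma Rintegral_bound D f (C : R) : measurable D -> measurable_fun D f ->
  (forall y, D y -> `|f y| <= C) ->
  `|\int[P]_(y in D) f y| <= C * fine (P D).
Proof.
move=> mD mf fC; have fi := bounded_integrable mD mf fC.
apply: (le_trans (le_normr_Rintegral mD fi)).
rewrite -Rintegral_cst//; apply: le_Rintegral => //.
  apply: (@bounded_integrable _ _ C) => //; first exact: measurableT_comp.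
  by move=> y Dy; rewrite normr_id; exact: fC.
exact: finite_measure_integrable_cst.
Qed.

Lemma Rintegral_bound1 f (C : R) : measurable_fun setT f ->
  (forall y, `|f y| <= C) -> `|\int[P]_y f y| <= C.
Proof.
move=> mf fC; have := @Rintegral_bound setT f C measurableT mf (fun y _ => fC y).
by rewrite probability_setT mulr1.
Qed.

Lemma Rintegral_cst1 (C : R) : \int[P]_y C = C.
Proof.
rewrite (@Rintegral_cst _ _ R P setT measurableT C) -[RHS]mulr1.
by congr (_ * _); rewrite -[RHS]/(fine 1%E) -(probability_setT P).
Qed.

End BoundedIntegrals.

Section Quadrature.
Context {R : realType}.
Variable gam : probability (measurableTypeR R) R.

Definition bounded_lipschitz (M L : R) (f : R -> R) :=
  (forall x, `|f x| <= M) /\ (forall x y, `|f x - f y| <= L * `|x - y|).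

Lemma lipschitz_continuous (L : R) (f : R -> R) :
  (forall x y, `|f x - f y| <= L * `|x - y|) -> continuous f.
Proof.
move=> fL x; apply/cvgrPdist_le => e e0.
have L0 : 0 < `|L| + 1 by rewrite ltr_wpDl.
have d0 : 0 < e / (`|L| + 1) by rewrite divr_gt0.
near=> y; apply: (le_trans (fL _ _)).
apply: (@le_trans _ _ ((`|L| + 1) * `|x - y|)).
  by rewrite ler_wpM2r// (le_trans (ler_norm L))// lerDl.
rewrite mulrC -ler_pdivlMr//; near: y.
Unshelve. all: by end_near. Qed.

(** The nodes and weights depend on the bounds [M] and [L] only.  A
    distribution commutes with finite sums but not obviously with integrals;
    a rule that is accurate for a whole family of functions at once bridges
    the gap in [U_semigroup].  The nodes are the left ends of equal cells in
    an interval carrying almost all the mass. *)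
Lemma quadrature (M L e : R) : 0 <= M -> 0 <= L -> 0 < e ->
  exists N (w y : nat -> R), forall f, bounded_lipschitz M L f ->
    `|\int[gam]_z f z - \sum_(j < N) w j * f (y j)| <= e.
Proof.
move=> M0 L0 e0.
have [A A0 HA] : exists2 A : R, 0 < A & M * fine (gam (~` `[- A, A[)) <= e / 2.
  have c0 : fine (gam (~` `[- (n%:R), n%:R[)) @[n --> \oo] --> (0 : R).
    apply: fine_cvg.
    have -> : (0 : R)%:E = gam (\bigcap_n (~` `[- (n%:R : R), n%:R[)).
      rewrite -[LHS](measure0 gam); congr (gam _); symmetry; rewrite -subset0 => z /=.
      move=> /(_ (Num.truncn `|z|).+1 I); apply => /=; rewrite in_itv /=.
      have := truncnS_gt `|z|; rewrite ltr_norml => /andP[/ltW -> ->] //.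
    apply: nonincreasing_cvg_mu => //.
    - by rewrite (le_lt_trans (probability_le1 _ _)) ?ltry//; exact: measurableC.
    - by move=> n; exact: measurableC.
    - by apply: bigcap_measurable => // n _; exact: measurableC.
    - move=> m n mn; apply/subsetPset; apply: subsetC => z /=; rewrite !in_itv /=.
      move=> /andP[h1 h2]; apply/andP; split.
        by apply: le_trans h1; rewrite lerN2 ler_nat.
      by apply: lt_le_trans h2 _; rewrite ler_nat.
  have e'0 : 0 < e / 2 / (M + 1) by rewrite !divr_gt0// ltr_wpDl.
  have /cvgr0Pnorm_le/(_ _ e'0) [n0 _ Hn] := c0.
  exists n0.+1%:R => //.
  have := Hn n0.+1 (leqnSn _); rewrite /= ger0_norm ?fine_ge0// => H.
  apply: (@le_trans _ _ ((M + 1) * (e / 2 / (M + 1)))).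
    by apply: ler_pM => //; rewrite ?fine_ge0// lerDl.
  by rewrite mulrC divfK// gt_eqF// ltr_wpDl.
have [N N0 HN] : exists2 N : nat, (0 < N)%N & L * (2 * A / N%:R) <= e / 2.
  exists (Num.truncn (L * (2 * A) / (e / 2))).+1 => //.
  rewrite mulrA ler_pdivrMr ?ltr0n// [leRHS]mulrC -ler_pdivrMr ?divr_gt0//.
  by rewrite ltW// truncnS_gt.
pose dl := 2 * A / N%:R; have dl0 : 0 < dl by rewrite divr_gt0 ?mulr_gt0 ?ltr0n.
pose y (j : nat) := - A + j%:R * dl.
pose w j := fine (gam `[y j, y j.+1[%classic).
exists N, w, y => f [fM fL].
have mf D : measurable_fun D f.
  by apply: measurable_funTS; apply: continuous_measurable_fun; exact: lipschitz_continuous fL.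
have yS j : y j < y j.+1 by rewrite /y ltrD2l ltr_pM2r// ltr_nat.
have y0 j : y 0%N <= y j by rewrite /y mul0r addr0 lerDl mulr_ge0// ltW.
have fi (D : set (measurableTypeR R)) : measurable D -> gam.-integrable D (EFin \o f).
  by move=> mD; exact: (@bounded_integrable R _ _ gam D f M mD (mf D) (fun z _ => fM z)).
have split k : [/\ [disjoint `[y 0%N, y k[ & `[y k, y k.+1[ ] &
    `[y 0%N, y k.+1[%classic = `[y 0%N, y k[ `|` `[y k, y k.+1[].
  split.
    rewrite disj_set2E; apply/eqP; rewrite -subset0 => z /= [].
    by rewrite !in_itv /= => /andP[_ h1] /andP[h2 _]; move: h1; rewrite ltNge h2.
  apply/seteqP; split => z /=; rewrite !in_itv /=.
    move=> /andP[h1 h2]; have [h|h] := ltP z (y k); first by left; rewrite h1.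
    by right.
  case=> /andP[h1 h2]; apply/andP; split => //.
    exact: lt_trans (yS k).
  exact: le_trans h1.
have key k : `|\int[gam]_(z in `[y 0%N, y k[) f z - \sum_(j < k) w j * f (y j)|
    <= L * dl * fine (gam `[y 0%N, y k[%classic).
  elim: k => [|k IH].
    have -> : `[y 0%N, y 0%N[%classic = set0 :> set (measurableTypeR R).
      by apply/seteqP; split => z //=; rewrite in_itv /= => /andP[h1]; rewrite ltNge h1.
    by rewrite Rintegral_set0 big_ord0 subrr normr0 measure0 mulr0.
  have [dis ->] := split k.
  rewrite Rintegral_setU//; last by apply: fi; exact: measurableU.
  rewrite big_ord_recr /= measureU//; last first.
    by move/eqP: dis.
  rewrite fineD ?fin_num_measure// mulrDr opprD addrACA.
  apply: le_trans (ler_normD _ _) (lerD IH _).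
  have -> : w k * f (y k) = \int[gam]_(z in `[y k, y k.+1[) f (y k).
    by rewrite Rintegral_cst// mulrC.
  rewrite -RintegralB//; [|exact: fi|]; last first.
    exact: finite_measure_integrable_cst.
  apply: Rintegral_bound => //; first by apply: measurable_funB; [exact: mf|exact: measurable_cst].
  move=> z /=; rewrite in_itv /= => /andP[h1 h2]; apply: (le_trans (fL _ _)).
  rewrite ler_wpM2l// ger0_norm ?subr_ge0// lerBlDl ltW// (lt_le_trans h2)//.
  by rewrite /y -natr1; lra.
have yN : `[y 0%N, y N[%classic = `[- A, A[%classic.
  have -> : y 0%N = - A by rewrite /y mul0r addr0.
  have -> // : y N = A.
  by rewrite /y /dl mulrC divfK ?pnatr_eq0 -?lt0n//; lra.
rewrite -(setUv `[- A, A[) Rintegral_setU; last 4 first.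
- exact: measurable_itv.
- by apply: measurableC; exact: measurable_itv.
- by rewrite setUv; exact: fi.
- by rewrite disj_set2E setICr.
have := key N; rewrite yN => kN.
rewrite addrAC [leRHS](splitr e); apply: le_trans (ler_normD _ _) (lerD _ _).
  apply: (le_trans kN); apply: le_trans HN; rewrite ler_piMr//.
    by rewrite mulr_ge0// ltW.
  by rewrite -lee_fin fineK ?fin_num_measure// probability_le1.
apply: le_trans HA; apply: Rintegral_bound; [apply: measurableC; exact: measurable_itv|exact: mf|by move=> z _; exact: fM].
Qed.

End Quadrature.

(** * U and the heat semigroup *)

Section Semigroup.
Context {R : realType}.
Implicit Types (s t x y v w e : R) (k i : nat).

Lemma tower_is_deriv (F : nat -> R -> R) k x : tower F -> (F k)^`()%classic x = F k.+1 x.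
Proof. by move=> tF; rewrite derive1E; exact: (@derive_val _ _ _ _ _ _ _ (tF k x)). Qed.

(** Differentiation under the integral sign, one order at a time. *)
Lemma tower_convolution (gam : probability (measurableTypeR R) R)
    (F f : nat -> R -> R) : tower F -> tower f ->
  (forall k, exists C : R, forall x, `|f k x| <= C) ->
  (forall w, F 0%N w = \int[gam]_y f 0%N (w + y)) ->
  forall k w, F k w = \int[gam]_y f k (w + y).
Proof.
move=> tF tf bf F0; elim=> [//|k IH] w.
have mf j x : measurable_fun setT (fun y : measurableTypeR R => f j (x + y)).
  apply: continuous_measurable_fun => y.
  apply: (@continuous_comp _ _ _ (fun y => x + y) (f j)).
    by apply: cvgD; [exact: cvg_cst|exact: cvg_id].
  by apply: differentiable_continuous; apply/derivable1_diffP; case: (tf j (x + y)).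
have df x y : is_derive x 1 (fun z => f k (z + y)) (f k.+1 (x + y)).
  have := @is_derive_mulr _ (f k) 1 y x _ (tf _ _).
  rewrite mul1r mulr1.
  by congr is_derive; apply/funext => z; rewrite mul1r.
have d1 x y : partial1of2 (fun x y => f k (x + y)) x y = f k.+1 (x + y).
  by rewrite partial1of2E; exact: (@derive_val _ _ _ _ _ _ _ (df x y)).
have [C HC] := bf k; have [C1 HC1] := bf k.+1.
rewrite -(tower_is_deriv k w tF).
have -> : F k = fun w => \int[gam]_y f k (w + y) by apply/funext.
rewrite (@differentiation_under_integral R _ _ gam (fun x y => f k (x + y)) setT
  measurableT w (w - 1) (w + 1) _ _ _ (fun=> `|C1|)).
- by apply: eq_Rintegral => y _; rewrite d1.
- by rewrite /= in_itv /= ltrBlDr ltrDl ltr01.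
- by move=> x _; apply: (@bounded_integrable _ _ _ _ _ _ C).
- by move=> x y _ _; case: (df x y).
- by move=> y.
- exact: finite_measure_integrable_cst.
- by move=> x y _ _; rewrite d1 (le_trans (HC1 _))// ler_norm.
Qed.

Lemma pairing_sum (mu : schwartz_distribution R) (b : R) N (c : nat -> R)
    (phi : nat -> R -> R) psi : compact (dist_supp mu) ->
  dist_supp mu `<=` `[b, +oo[ -> smooth psi -> (forall j, smooth (phi j)) ->
  pairing mu (fun v => psi v - \sum_(j < N) c j * phi j v) =
  pairing mu psi - \sum_(j < N) c j * pairing mu (phi j).
Proof.
move=> cmu smu spsi sphi.
have sS n : smooth (fun v => psi v - \sum_(j < n) c j * phi j v).
  elim: n => [|n IH].
    rewrite (_ : (fun v => _) = psi)//.
    by apply/funext => v; rewrite big_ord0 subr0.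
  rewrite (_ : (fun v => _) = fun v => - c n * phi n v +
    (psi v - \sum_(j < n) c j * phi j v)).
    exact: (@smoothD _ _ _ (@smoothZ _ (- c n) _ (sphi n)) IH).
  by apply/funext => v; rewrite big_ord_recr /=; ring.
elim: N => [|N IH].
  rewrite big_ord0 subr0; congr (pairing mu _).
  by apply/funext => v; rewrite big_ord0 subr0.
rewrite big_ord_recr /= opprD addrA -IH addrC -mulNr.
rewrite -(pairing_linear _ cmu smu (sphi N) (sS N)); congr (pairing mu _).
by apply/funext => v; rewrite big_ord_recr /= opprD mulNr addrA addrC.
Qed.

Lemma tower_sum N (c : nat -> R) (F : nat -> nat -> R -> R) (f : nat -> R -> R) :
  tower f -> (forall j, tower (F j)) ->
  tower (fun k v => f k v - \sum_(j < N) c j * F j k v).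
Proof.
move=> tf tF.
elim: N => [|N IH] m x.
  have := tf m x; congr is_derive; last by rewrite big_ord0 subr0.
  by apply/funext => v; rewrite big_ord0 subr0.
have d := @is_deriveB _ _ _ _ _ _ _ _ _ (IH m x)
   (@is_deriveZ _ _ _ _ (c N) _ _ _ (tF N m x)).
move: d; congr is_derive.
  by apply/funext => v; rewrite !fctE big_ord_recr /= opprD addrA.
by rewrite big_ord_recr /= opprD addrA.
Qed.

(** Both sides are close to the same quadrature sum.  On the left, the
    kernel at time [s] and the quadrature sum of kernels at time [t] differ
    little together with their derivatives, so [pairing_estimate] bounds the
    difference of the pairings; on the right the quadrature is applied to [x
    |-> U(x, t)] itself, which is bounded and Lipschitz. *)
Lemma U_semigroup (T b : R) (mu : schwartz_distribution R)
    (gam : probability (measurableTypeR R) R) s t x :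
  compact (dist_supp mu) -> dist_supp mu `<=` `[b, +oo[ ->
  s < T -> t < T ->
  (forall w, heat (Num.sqrt (T - s)) 0 w = \int[gam]_y heat (Num.sqrt (T - t)) 0 (w + y)) ->
  U T x s mu = \int[gam]_y U T (x + y) t mu.
Proof.
move=> cmu smu sT tT Hconv.
set ss := Num.sqrt (T - s) in Hconv *; set st := Num.sqrt (T - t) in Hconv *.
have st0 : 0 < st by rewrite sqrtr_gt0 subr_gt0.
have bh k : exists C : R, forall x, `|heat st k x| <= C.
  have [C _ HC] := heat_bounded k st0.
  by exists C => z; exact: HC.
have Hk := tower_convolution (tower_heat ss) (tower_heat st) bh Hconv.
have [|C [K [m [C0 HC]]]] := pairing_estimate (a := b - 1) cmu smu.
  by rewrite ltrBlDr ltrDl.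
have [B B0 HB] := heat_bounded m.+1 st0.
have [MU MU0 HMU] := U_bounded cmu smu tT.
have [LU LU0 HLU] := U_lipschitz cmu smu tT.
(* Both sides are within [C * e'] and [e'] of the sum, for [e' = e / (C + 1)]. *)
apply/eqP; rewrite -subr_eq0 -normr_eq0 eq_le normr_ge0 andbT.
apply/ler_addgt0Pl => e e0; rewrite addr0.
have e'0 : 0 < e / (C + 1) by rewrite divr_gt0// ltr_wpDl.
have [N [w [y Hq]]] := quadrature gam (addr_ge0 B0 MU0) (addr_ge0 B0 LU0) e'0.
have q1 : `|U T x s mu - \sum_(j < N) w j * U T (x + y j) t mu| <= C * (e / (C + 1)).
  rewrite UE//; under eq_bigr do rewrite UE//.
  have sh := @heat_smooth _ ss x.
  have shj j := @heat_smooth _ st (x + y j).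
  rewrite -(pairing_sum N w cmu smu sh shj).
  have tS := tower_sum N w (tower_refl x (tower_heat ss))
    (fun j => tower_refl (x + y j) (tower_heat st)).
  set psi := (fun v => _ - _).
  have psiE : psi = (fun v => (-1) ^+ 0 * heat ss 0 (x - v) -
      \sum_(j < N) w j * ((-1) ^+ 0 * heat st 0 (x + y j - v))).
    apply/funext => v; rewrite expr0 mul1r; congr (_ - _).
    by apply: eq_bigr => j _; rewrite mul1r.
  apply: HC.
    by rewrite psiE; exact: (tower_smooth tS).
  move=> i v im _.
  rewrite psiE (tower_derive1n i tS).
  have -> : (-1) ^+ i * heat ss i (x - v) -
      \sum_(j < N) w j * ((-1) ^+ i * heat st i (x + y j - v))
      = (-1) ^+ i * (heat ss i (x - v) - \sum_(j < N) w j * heat st i (x + y j - v)).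
    rewrite mulrBr; congr (_ - _); rewrite mulr_sumr.
    by apply: eq_bigr => j _; rewrite mulrCA.
  rewrite normr_signM Hk.
  have := Hq (fun z => heat st i (x - v + z)) _.
  under [in X in _ -> X]eq_bigr do rewrite addrAC.
  apply; split => [z|z z'].
    by apply: (le_trans (HB _ _ _ _ _)) => //; rewrite ?lerDl// (leq_trans im).
  apply: (@le_trans _ _ (B * `|z - z'|)); last by rewrite ler_wpM2r// lerDl.
  have -> : z - z' = (x - v + z) - (x - v + z') by ring.
  by apply: (bounded_deriv_lipschitz (tower_heat _ i)) => u; exact: HB.
have q2 : `|\int[gam]_z U T (x + z) t mu - \sum_(j < N) w j * U T (x + y j) t mu|
    <= e / (C + 1).
  apply: (Hq (fun z => U T (x + z) t mu)); split => [z|z z'].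
    by apply: (le_trans (HMU _ _ _)) => //; rewrite lerDr.
  have -> : z - z' = (x + z) - (x + z') by ring.
  by apply: (le_trans (HLU _ _)) => //; rewrite ler_wpM2r// lerDr.
have -> : U T x s mu - \int[gam]_z U T (x + z) t mu =
  (U T x s mu - \sum_(j < N) w j * U T (x + y j) t mu) -
  (\int[gam]_z U T (x + z) t mu - \sum_(j < N) w j * U T (x + y j) t mu).
  by rewrite opprB addrA subrK.
apply: (le_trans (ler_normB _ _)); apply: (le_trans (lerD q1 q2)).
rewrite -[X in _ + X]mul1r -mulrDl mulrC divfK//.
by rewrite gt_eqF// ltr_wpDl.
Qed.

End Semigroup.

(** * Brownian increments are independent of the past *)

Section IndependentOfPast.
Context {R : realType} {d : measure_display} {Omega : measurableType d}.
Variables (P : probability Omega R) (W : R -> Omega -> R).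
Hypothesis hW : brownian_motion P W.

(** Dynkin's lemma for the finite measures [A |-> P (A /\ E)] and [A |-> P A
    * P E]. *)
Lemma indep_sigma (G : set (set Omega)) (E : set Omega) : measurable E ->
  G `<=` measurable -> setI_closed G ->
  (forall A, G A -> P (A `&` E) = P A * P E)%E ->
  forall A, <<s G >> A -> (P (A `&` E) = P A * P E)%E.
Proof.
move=> mE mG IG HG A.
pose H := [set X | G X /\ X `<=` [set: Omega]].
have HGE : H = G by apply/seteqP; split => [X []//|X GX]; split.
have p0 : 0 <= fine (P E) by exact: fine_ge0.
pose m1 : {measure set Omega -> \bar R} := mrestr P mE.
pose m2 : {measure set Omega -> \bar R} := mscale (NngNum p0) P.
have m2E X : m2 X = (P X * P E)%E.
  rewrite /m2 /= /mscale muleC; congr (_ * _)%E.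
  by apply: fineK; exact: fin_num_measure.
have := @g_sigma_algebra_measure_unique_trace _ R _ G setT measurableT.
rewrite -/H HGE => /(_ mG IG m1 m2) key GA.
rewrite -m2E -[LHS]/(m1 A); apply: key => //.
- by rewrite m2E /m1 /= /mrestr setTI probability_setT mul1e.
- by move=> X GX; rewrite m2E; exact: HG.
- by rewrite /m1 /= /mrestr setTI (le_lt_trans (probability_le1 _ _))// ltry.
Qed.

Variable s : R.
Hypothesis s0 : 0 <= s.

Definition grid m k : R := s * (k%:R / 2 ^+ m).

Definition incr m k w := W (grid m k.+1) w - W (grid m k) w.

(** Independence is known for increments, hence a pi-system made of
    conditions on increments instead of values. *)
Definition rects m : set (set Omega) :=
  [set A | exists2 B : nat -> set R, (forall i, measurable (B i)) &
     A = [set w | forall i, (i < 2 ^ m)%N -> B i (incr m i w)]].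

(** A union of sigma-algebras.  Rectangles of different levels do not
    intersect in a rectangle, but the sigma-algebras are nested, so this
    union is again a pi-system.  It generates the dyadic past of time [s],
    which determines the whole past by continuity of the paths. *)
Definition past : set (set Omega) := [set A | exists m, <<s rects m >> A].

Lemma grid_ge0 m k : 0 <= grid m k.
Proof. by rewrite /grid mulr_ge0// divr_ge0// exprn_ge0. Qed.

Lemma grid_le m k : grid m k <= grid m k.+1.
Proof. by rewrite /grid ler_wpM2l// ler_pM2r ?invr_gt0 ?exprn_gt0// ler_nat. Qed.

Lemma grid0 m : grid m 0 = 0.
Proof. by rewrite /grid mul0r mulr0. Qed.

Lemma grid_end m : grid m (2 ^ m) = s.
Proof. by rewrite /grid natrX divff ?mulr1// expf_neq0. Qed.

Lemma grid_refine m k : grid m k = grid m.+1 (2 * k).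
Proof.
by rewrite /grid exprS natrM invfM mulrACA divff ?mul1r// pnatr_eq0.
Qed.

Lemma measurable_incr m k : measurable_fun setT (incr m k).
Proof. by apply: measurable_funB; apply: bm_measurable hW _ _; exact: grid_ge0. Qed.

Lemma rect_bigcap m (B : nat -> set R) :
  [set w | forall i, (i < 2 ^ m)%N -> B i (incr m i w)] =
  \bigcap_i (if (i < 2 ^ m)%N then incr m i @^-1` B i else setT).
Proof.
apply/seteqP; split => w /= H i.
  by move=> _; case: ifPn => // im; exact: H.
by move=> im; have := H i I; rewrite im.
Qed.

Lemma measurable_rects m : rects m `<=` measurable.
Proof.
move=> _ [B mB ->]; rewrite rect_bigcap; apply: bigcap_measurable => // i _.
case: ifPn => // _; rewrite -[X in measurable X]setTI.
exact: measurable_incr.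
Qed.

Lemma rects_setI m : setI_closed (rects m).
Proof.
move=> _ _ [B mB ->] [C mC ->]; exists (fun i => B i `&` C i).
  by move=> i; exact: measurableI.
apply/seteqP; split => w /=.
  by move=> [HB HC] i im; split; [exact: HB|exact: HC].
by move=> H; split=> i /H[].
Qed.

Lemma rects_incr m k : (k < 2 ^ m)%N ->
  measurable_fun setT (incr m k : g_sigma_algebraType (rects m) -> R).
Proof.
move=> km _ B mB; apply: sub_sigma_algebra.
exists (fun i => if i == k then B else setT) => [i|]; first by case: ifP.
apply/seteqP; split => w /=.
  by move=> [_ Bw] i im; case: eqP => [->|].
by move=> /(_ k km); rewrite eqxx.
Qed.

Lemma rects_W m k : (k <= 2 ^ m)%N ->
  measurable_fun setT (W (grid m k) : g_sigma_algebraType (rects m) -> R).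
Proof.
elim: k => [_|k IH km].
  rewrite grid0 (_ : W 0 = cst 0); first exact: measurable_cst.
  by apply/funext => w; rewrite (bm_start hW).
rewrite (_ : W _ = (W (grid m k) \+ incr m k)).
  by apply: measurable_funD; [apply: IH; exact: ltnW|exact: rects_incr].
by apply/funext => w; rewrite /incr /= addrC subrK.
Qed.

Lemma rects_refine m : <<s rects m >> `<=` <<s rects m.+1 >>.
Proof.
apply: smallest_sub; first exact: smallest_sigma_algebra.
move=> _ [B mB ->]; rewrite rect_bigcap.
apply: (@bigcap_measurable _ (g_sigma_algebraType (rects m.+1))) => // i _.
case: ifPn => [im|_]; last exact: measurableT.
have km : ((2 * i.+1) <= 2 ^ m.+1)%N by rewrite expnS leq_mul2l.
have := measurable_funB (rects_W km) (rects_W (leq_trans _ km)).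
move=> /(_ (2 * i)%N) H; have {}H := H _.
have mi : measurable_fun setT (incr m i : g_sigma_algebraType (rects m.+1) -> R).
  rewrite (_ : incr m i = fun w => W (grid m.+1 (2 * i.+1)) w - W (grid m.+1 (2 * i)) w).
    by apply: H; rewrite leq_mul2l /=.
  by apply/funext => w; rewrite /incr -!grid_refine.
by rewrite -[X in measurable X]setTI; exact: mi.
Qed.

Lemma rects_mono m n : (m <= n)%N -> <<s rects m >> `<=` <<s rects n >>.
Proof.
elim: n => [|n IH]; first by rewrite leqn0 => /eqP ->.
rewrite leq_eqVlt => /orP[/eqP -> //|mn]; apply: subset_trans (IH mn) _.
exact: rects_refine.
Qed.

Lemma measurable_sigma_rects m : <<s rects m >> `<=` @measurable d Omega.
Proof.
apply: smallest_sub; [exact: sigma_algebra_measurable|exact: measurable_rects].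
Qed.

Lemma measurable_past : past `<=` measurable.
Proof. by move=> A [m]; exact: measurable_sigma_rects. Qed.

Lemma past_setI : setI_closed past.
Proof.
move=> A B [m mA] [n nB]; exists (maxn m n).
apply: (@measurableI _ (g_sigma_algebraType (rects (maxn m n)))).
  by apply: rects_mono mA; exact: leq_maxl.
by apply: rects_mono nB; exact: leq_maxr.
Qed.

(** Dynkin's lemma twice: from rectangles of a fixed level to the
    sigma-algebra of that level, then to the sigma-algebra generated by all
    levels. *)
Lemma past_indep t (B : set R) A : s < t -> measurable B -> <<s past >> A ->
  (P (A `&` [set w | B (W t w - W s w)%R]) = P A * P [set w | B (W t w - W s w)%R])%E.
Proof.
move=> st mB.
have mE : measurable [set w | B (W t w - W s w)].
  rewrite -[X in measurable X]setTI.
  by apply: measurable_funB => //; apply: bm_measurable hW _ _ => //; rewrite ltW// (le_lt_trans s0).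
apply: indep_sigma => //; [exact: measurable_past|exact: past_setI|].
move=> {}A [m]; apply: indep_sigma => //; [exact: measurable_rects|exact: rects_setI|].
move=> _ [C mC ->].
(* Append the increment from [s] to [t] to the grid of level [m]. *)
pose tt i := if (i <= 2 ^ m)%N then grid m i else t.
pose BB i := if (i < 2 ^ m)%N then C i else B.
have tt0 : 0 <= tt 0%N by rewrite /tt /= grid_ge0.
have ttS i : tt i <= tt i.+1.
  rewrite /tt; have [im|im] := ltnP i (2 ^ m)%N; first by rewrite (ltnW im) grid_le.
  case: ifP => // im'; have -> : i = (2 ^ m)%N by apply/eqP; rewrite eqn_leq im' im.
  by rewrite grid_end ltW.
have mBB i : measurable (BB i) by rewrite /BB; case: ifP.
have full := bm_independent hW (n := (2 ^ m).+1) tt0 (fun i _ => ttS i) (fun i _ => mBB i).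
have part := bm_independent hW (n := (2 ^ m)%N) tt0 (fun i _ => ttS i) (fun i _ => mBB i).
have ttE i w : (i < 2 ^ m)%N -> W (tt i.+1) w - W (tt i) w = incr m i w.
  by move=> im; rewrite /tt im (ltnW im).
have lastE w : W (tt (2 ^ m)%N.+1) w - W (tt (2 ^ m)%N) w = W t w - W s w.
  by rewrite /tt ltnn leqnn grid_end.
have e1 : [set w | forall i, (i < 2 ^ m)%N -> C i (incr m i w)] =
    [set w | forall i, (i < 2 ^ m)%N -> BB i (W (tt i.+1) w - W (tt i) w)].
  apply/seteqP; split => w /= H i im; have := H i im; rewrite ttE// /BB im //.
have e2 : [set w | B (W t w - W s w)] =
    [set w | BB (2 ^ m)%N (W (tt (2 ^ m)%N.+1) w - W (tt (2 ^ m)%N) w)].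
  by apply/seteqP; split => w /=; rewrite lastE /BB ltnn.
rewrite e1 e2 part -[RHS](big_ord_recr (2 ^ m)%N (fun i => P [set w | BB i (W (tt i.+1) w - W (tt i) w)])) -full.
congr (P _); apply/seteqP; split => w /=.
  move=> [H1 H2] i; rewrite ltnS leq_eqVlt => /orP[/eqP -> //|]; exact: H1.
by move=> H; split => [i im|]; apply: H => //; rewrite ltnS ltnW.
Qed.

End IndependentOfPast.

(** * Integrals of functions of independent variables *)

Section IndependentIntegrals.
Context {R : realType} {d d1 : measure_display} {Omega : measurableType d}.
Variables (P : probability Omega R) (T1 : measurableType d1).
Variables (X : Omega -> T1) (Y : Omega -> R).
Variable gam : probability (measurableTypeR R) R.
Hypothesis mX : measurable_fun setT X.
Hypothesis mY : measurable_fun setT Y.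
Hypothesis XY : forall C B, measurable C -> measurable B ->
  (P (X @^-1` C `&` Y @^-1` B) = P (X @^-1` C) * gam B)%E.

(** Independence makes the law of (X, Y) a product measure, and Tonelli's
    theorem applies.  The space of values of [X] is arbitrary, so that [X]
    can stand for the whole past of a process. *)
Lemma indep_ge0_integral (h : T1 * measurableTypeR R -> \bar R) :
  measurable_fun setT h -> (forall z, 0 <= h z)%E ->
  (\int[P]_w h (X w, Y w) = \int[P]_w \int[gam]_y h (X w, y))%E.
Proof.
move=> mh h0.
pose mXb := isMeasurableFun.Build _ _ _ _ X mX.
pose X' : {mfun Omega >-> T1} := HB.pack X mXb.
pose nu : probability T1 R := distribution P X'.
have mXY : measurable_fun setT (fun w => (X w, Y w) : T1 * measurableTypeR R).
  exact: measurable_fun_pair.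
transitivity (\int[pushforward P (fun w => (X w, Y w) : T1 * measurableTypeR R)]_z h z)%E.
  by rewrite (ge0_integral_pushforward mXY).
transitivity (\int[nu \x gam]_z h z)%E.
  apply: eq_measure_integral => A mA _.
  rewrite [LHS](_ : _ = pushforward P (fun w => (X w, Y w) : T1 * measurableTypeR R) A)//.
  symmetry; apply: (product_measure_unique (m1 := nu) (m2 := gam)) => //.
rewrite fubini_tonelli1//.
rewrite (ge0_integral_pushforward mX)//.
- exact: measurable_fun_fubini_tonelli_F.
- by move=> y _; apply: integral_ge0.
Qed.

(** Adding the bound [C] reduces the bounded case to the nonnegative one. *)
Lemma indep_integral (h : T1 * measurableTypeR R -> R) (C : R) :
  measurable_fun setT h -> (forall z, `|h z| <= C) ->
  \int[P]_w h (X w, Y w) = \int[P]_w \int[gam]_y h (X w, y).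
Proof.
move=> mh hC.
pose H z : \bar R := (h z + C)%:E.
have mH : measurable_fun setT H.
  by apply/measurable_EFinP; apply: measurable_funD.
have H0 z : (0 <= H z)%E.
  by rewrite lee_fin -lerBlDr sub0r; have := hC z; rewrite ler_norml => /andP[].
have mXY : measurable_fun setT (fun w => (X w, Y w) : T1 * measurableTypeR R).
  exact: measurable_fun_pair.
have mhX x : measurable_fun setT (fun y => h (x, y)).
  exact: measurableT_comp mh (measurable_pair1 x).
have ig x : gam.-integrable setT (EFin \o (fun y => h (x, y))).
  by apply: (@bounded_integrable _ _ _ _ _ _ C).
have EH x : (\int[gam]_y H (x, y))%E = (\int[gam]_y h (x, y) + C)%:E.
  rewrite -[LHS]fineK; last first.
    apply: integrable_fin_num => //.
    apply: (@bounded_integrable _ _ _ gam setT (fun y => h (x, y) + C) (C + `|C|)) => //.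
      by apply: measurable_funD.
    by move=> y _; apply: le_trans (ler_normD _ _) (lerD _ _).
  congr EFin; rewrite -/(Rintegral _ _ (fun y => h (x, y) + C)) RintegralD//.
    by rewrite (Rintegral_cst1 gam).
  exact: finite_measure_integrable_cst.
have mI : measurable_fun setT (fun w => \int[gam]_y h (X w, y)).
  have m1 : measurable_fun setT (fun x => \int[gam]_y H (x, y))%E.
    exact: measurable_fun_fubini_tonelli_F.
  have m2 : measurable_fun setT (fun x => \int[gam]_y h (x, y) + C).
    apply/measurable_EFinP.
    rewrite (_ : EFin \o _ = fun x => \int[gam]_y H (x, y))%E //.
    by apply/funext => x; rewrite EH.
  have m3 : measurable_fun setT (fun x => \int[gam]_y h (x, y)).
    rewrite (_ : (fun x => _) = (fun x => (\int[gam]_y h (x, y) + C) - C)).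
      exact: measurable_funB.
    by apply/funext => x; rewrite addrK.
  exact: measurableT_comp m3 mX.
have key := indep_ge0_integral mH H0.
have i1 : P.-integrable setT (EFin \o (fun w => h (X w, Y w))).
  by apply: (@bounded_integrable _ _ _ _ _ _ C) => //; exact: measurableT_comp mh mXY.
have i2 : P.-integrable setT (EFin \o (fun w => \int[gam]_y h (X w, y))).
  apply: (@bounded_integrable _ _ _ _ _ _ C) => // w _.
  exact: Rintegral_bound1.
have ic : P.-integrable setT (EFin \o (fun _ : Omega => C)).
  exact: finite_measure_integrable_cst.
apply: (@addIr _ (\int[P]_w C)).
rewrite -!RintegralD//.
rewrite /Rintegral; congr fine.
rewrite -[LHS]/(\int[P]_w H (X w, Y w))%E key.
by apply: eq_integral => w _; rewrite EH.
Qed.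

End IndependentIntegrals.

(** The case of a constant [X] in [indep_integral]. *)
Lemma integral_law {R : realType} {d} {Omega : measurableType d}
    (P : probability Omega R) (Y : Omega -> R)
    (gam : probability (measurableTypeR R) R) (f : measurableTypeR R -> R) (C : R) :
  measurable_fun setT Y ->
  (forall B, measurable B -> P (Y @^-1` B) = gam B) ->
  measurable_fun setT f -> (forall y, `|f y| <= C) ->
  \int[P]_w f (Y w) = \int[gam]_y f y.
Proof.
move=> mY PY mf fC.
pose z := (fun _ : Omega => 0 : R).
have XY (D B : set R) : measurable D -> measurable B ->
    (P (z @^-1` D `&` Y @^-1` B) = P (z @^-1` D) * gam B)%E.
  move=> mD mB; have [D0|D0] := pselect (D 0).
    rewrite (_ : z @^-1` D = setT); last by apply/seteqP; split.
    by rewrite setTI probability_setT mul1e PY.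
  rewrite (_ : z @^-1` D = set0); last by apply/seteqP; split.
  by rewrite set0I measure0 mul0e.
have := @indep_integral _ _ _ _ P _ z Y gam (measurable_cst _) mY XY
  (fun p => f p.2) C (measurableT_comp mf measurable_snd) (fun p => fC p.2).
by move=> -> /=; rewrite (Rintegral_cst1 P).
Qed.

Section Markov.
Context {R : realType} {d : measure_display} {Omega : measurableType d}.
Variables (P : probability Omega R) (W : R -> Omega -> R).
Hypothesis hW : brownian_motion P W.

(** The increment [W_T - W_s] is the sum of the independent increments [W_t
    - W_s] and [W_T - W_t]; averaging the distribution function of the
    second over the first gives that of the sum.  The symmetry of the normal
    law turns [w - y] into [w + y]. *)
Lemma heat_convolution (T s t w : R) : 0 <= s -> s < t -> t < T ->
  heat (Num.sqrt (T - s)) 0 w =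
  \int[normal_prob 0 (Num.sqrt (t - s))]_y heat (Num.sqrt (T - t)) 0 (w + y).
Proof.
move=> s0 st tT.
have sT := lt_trans st tT; have t0 : 0 <= t by rewrite ltW// (le_lt_trans s0).
have T0 : 0 <= T by rewrite ltW// (le_lt_trans t0).
have ss : 0 < Num.sqrt (T - s) by rewrite sqrtr_gt0 subr_gt0.
have st0 : 0 < Num.sqrt (T - t) by rewrite sqrtr_gt0 subr_gt0.
have heatE sg z : heat sg 0 z = normal_cdf (z / sg) by rewrite /heat expr0 mul1r.
set g1 := normal_prob 0 (Num.sqrt (t - s)) : probability (measurableTypeR R) R.
set g2 := normal_prob 0 (Num.sqrt (T - t)) : probability (measurableTypeR R) R.
set g3 := normal_prob 0 (Num.sqrt (T - s)) : probability (measurableTypeR R) R.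
pose X om := W t om - W s om; pose Y om := W T om - W t om.
have mX : measurable_fun setT X.
  by apply: measurable_funB; apply: bm_measurable hW _ _.
have mY : measurable_fun setT Y.
  by apply: measurable_funB; apply: bm_measurable hW _ _.
have PX B : measurable B -> P (X @^-1` B) = g1 B by exact: (bm_gaussian hW s0 st).
have PY B : measurable B -> P (Y @^-1` B) = g2 B by exact: (bm_gaussian hW t0 tT).
have bN y : `|normal_cdf y : R| <= 1.
  by rewrite ger0_norm ?normal_cdf_ge0// normal_cdf_le1.
have mN z : measurable_fun setT
    (fun y : measurableTypeR R => normal_cdf ((z - y) / Num.sqrt (T - t))).
  apply: (@measurableT_comp _ _ _ _ _ _ (@normal_cdf R)).
    apply: continuous_measurable_fun => y.
    apply: differentiable_continuous; apply/derivable1_diffP.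
    by case: (is_derive_normal_cdf y).
  apply: measurable_funM; last exact: measurable_cst.
  by apply: measurable_funB; [exact: measurable_cst|exact: measurable_id].
have ind (C B : set R) : measurable C -> measurable B ->
    (P (X @^-1` C `&` Y @^-1` B) = P (X @^-1` C) * g2 B)%E.
  move=> mC mB; rewrite -PY//.
  pose tt i := if i is j.+1 then if j is _.+1 then T else t else s.
  pose BB (i : nat) := if i is 0%N then C else B.
  have tt0 : 0 <= tt 0%N by [].
  have ttS i : (i < 2)%N -> tt i <= tt i.+1 by case: i => [|[|]] //= _; exact: ltW.
  have mBB i : (i < 2)%N -> measurable (BB i) by case: i.
  have := bm_independent hW tt0 ttS mBB.
  rewrite !big_ord_recl big_ord0 /= mule1 => <-; congr (P _).
  apply/seteqP; split => om /=; first by move=> [h1 h2] [|[|]].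
  by move=> H; split; [exact: (H 0%N)|exact: (H 1%N)].
(* [h] is the indicator of the event that the sum of the two increments is at
   most [z]; integrating out the second increment leaves its distribution
   function at [z - y]. *)
have conv z : ncdf (Num.sqrt (T - s)) z = \int[g1]_y normal_cdf ((z - y) / Num.sqrt (T - t)).
  pose h (p : measurableTypeR R * measurableTypeR R) : R := \1_[set r : R | r <= z] (p.1 + p.2).
  have mset : measurable [set r : R | r <= z].
    by rewrite (_ : [set r | _] = `]-oo, z]%classic)//; apply/seteqP; split => r /=; rewrite in_itv.
  have mh : measurable_fun setT h.
    apply: measurableT_comp; first exact: measurable_indic.
    by apply: measurable_funD; [exact: measurable_fst|exact: measurable_snd].
  have hb p : `|h p| <= 1.
    by rewrite /h indicE; case: (_ \in _); rewrite ?normr1 ?normr0.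
  have := indep_integral mX mY ind mh hb.
  have -> : \int[P]_om h (X om, Y om) = ncdf (Num.sqrt (T - s)) z.
    have -> : \int[P]_om h (X om, Y om) = \int[P]_om \1_[set om | W T om - W s om <= z] om.
      apply: eq_Rintegral => om _; rewrite /h /= /X /Y.
      rewrite (_ : _ + _ = W T om - W s om); last by ring.
      by [].
    rewrite /Rintegral integral_indic//; last first.
      rewrite -[X in measurable X]setTI.
      have mZ : measurable_fun setT (fun om => W T om - W s om).
        by apply: measurable_funB; apply: bm_measurable hW _ _.
      exact: (mZ measurableT _ mset).
    rewrite setIT /ncdf -(bm_gaussian hW s0 sT (measurable_itv `]-oo, z])).
    by congr (fine (P _)); apply/seteqP; split => om /=; rewrite in_itv.
  move=> ->.
  have -> : \int[P]_om \int[g2]_y h (X om, y) =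
      \int[P]_om normal_cdf ((z - X om) / Num.sqrt (T - t)).
    apply: eq_Rintegral => om _.
    rewrite -ncdf_scale// /ncdf.
    have -> : \int[g2]_y h (X om, y) = \int[g2]_y \1_`]-oo, (z - X om)] y.
      apply: eq_Rintegral => y _; rewrite /h /= !indicE !mem_setE /=.
      by congr ((_ : bool)%:R); rewrite in_itv /= lerBrDl.
    by rewrite /Rintegral integral_indic// setIT.
  exact: (@integral_law R d Omega P X g1 (fun y => normal_cdf ((z - y) / Num.sqrt (T - t)))
    1 mX PX (mN z) (fun y => bN _)).
have cE y : normal_cdf ((w + y) / Num.sqrt (T - t)) =
    1 - normal_cdf ((- w - y) / Num.sqrt (T - t)).
  by rewrite -normal_cdfN -opprD mulNr opprK.
rewrite heatE; under eq_Rintegral do rewrite heatE cE.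
rewrite RintegralB//; last 2 first.
- exact: finite_measure_integrable_cst.
- apply: (@bounded_integrable _ _ _ g1 setT _ 1) => //.
by rewrite -conv (Rintegral_cst1 g1) ncdf_scale// -normal_cdfN mulNr opprK.
Qed.

End Markov.

(** * The Markov property and the event of not having hit the boundary *)

Section MarkovProperty.
Context {R : realType} {d : measure_display} {Omega : measurableType d}.
Variables (P : probability Omega R) (W : R -> Omega -> R).
Hypothesis hW : brownian_motion P W.

Lemma past_W s : 0 <= s ->
  measurable_fun setT (W s : g_sigma_algebraType (past W s) -> R).
Proof.
move=> s0 _ B mB; apply: sub_sigma_algebra; exists 0%N.
have := @rects_W _ _ _ _ _ hW s 0%N (2 ^ 0)%N (leqnn _).
by rewrite (grid_end s 0); apply.
Qed.

Lemma past_grid s m k : 0 <= s -> (k <= 2 ^ m)%N ->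
  measurable_fun setT (W (grid s m k) : g_sigma_algebraType (past W s) -> R).
Proof.
move=> s0 km _ B mB; apply: sub_sigma_algebra; exists m.
exact: (@rects_W _ _ _ _ _ hW s m k km).
Qed.

Lemma sigma_past_measurable s : 0 <= s -> <<s past W s >> `<=` @measurable d Omega.
Proof.
move=> s0; apply: smallest_sub; first exact: sigma_algebra_measurable.
exact: (measurable_past hW s0).
Qed.

(** Here [X] is the identity, viewed as a map to [Omega] with the
    sigma-algebra of the past; both [A] and [W s] are measurable there. *)
Lemma markov_property s t A (f : R -> R) (C : R) : 0 <= s -> s < t -> <<s past W s >> A ->
  measurable_fun setT f -> (forall x, `|f x| <= C) ->
  \int[P]_w (\1_A w * f (W t w)) =
  \int[P]_w (\1_A w * \int[normal_prob 0 (Num.sqrt (t - s))]_y f (W s w + y)).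
Proof.
move=> s0 st GA mf fC.
set gam := normal_prob 0 (Num.sqrt (t - s)) : probability (measurableTypeR R) R.
pose T1 := g_sigma_algebraType (past W s).
pose X : Omega -> T1 := id.
pose Y w := W t w - W s w.
have t0 : 0 <= t by rewrite ltW// (le_lt_trans s0).
have mX : measurable_fun setT X.
  by move=> _ B mB; rewrite setTI; exact: (sigma_past_measurable s0).
have mY : measurable_fun setT Y.
  by apply: measurable_funB; apply: bm_measurable hW _ _.
have PY B : measurable B -> P (Y @^-1` B) = gam B by exact: (bm_gaussian hW s0 st).
have XY (D : set T1) (B : set R) : measurable D -> measurable B ->
    (P (X @^-1` D `&` Y @^-1` B) = P (X @^-1` D) * gam B)%E.
  by move=> mD mB; rewrite -PY//; exact: (past_indep hW s0 st mB mD).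
pose h (z : T1 * measurableTypeR R) : R := \1_A z.1 * f (W s z.1 + z.2).
have mA : measurable (A : set T1) by exact: GA.
have mh : measurable_fun setT h.
  apply: measurable_funM.
    have mI : measurable_fun setT (\1_(A : set T1) : T1 -> R) by exact: measurable_indic.
    exact: (measurableT_comp mI measurable_fst).
  apply: (measurableT_comp mf); apply: measurable_funD; last exact: measurable_snd.
  by apply: (measurableT_comp (past_W s0)); exact: measurable_fst.
have hC z : `|h z| <= C.
  rewrite /h normrM indicE; case: (_ \in _); rewrite ?normr1 ?mul1r//.
  by rewrite normr0 mul0r (le_trans (normr_ge0 (f 0))).
have := indep_integral mX mY XY mh hC.
have -> : \int[P]_w h (X w, Y w) = \int[P]_w (\1_A w * f (W t w)).
  by apply: eq_Rintegral => w _; rewrite /h /X /Y /= addrC subrK.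
move=> ->; apply: eq_Rintegral => w _; rewrite /h /X /=.
rewrite RintegralZl//.
apply: (@bounded_integrable _ _ _ gam setT _ C) => //.
apply: (measurableT_comp mf).
by apply: measurable_funD; [exact: measurable_cst|exact: measurable_id].
Qed.

End MarkovProperty.

Section Alive.
Context {R : realType} {d : measure_display} {Omega : measurableType d}.
Variables (P : probability Omega R) (W : R -> Omega -> R).
Hypothesis hW : brownian_motion P W.
Variables (T : R) (g : R -> R) (u : R).
Hypothesis hg : {within `[0, T], continuous g}.

(** For [t < T] this is the event that the boundary has not been hit up to
    time [t], see [alive_hitting_time]. *)
Definition alive t : set Omega :=
  [set w | forall r, 0 <= r <= t -> u + W r w < g r].

Lemma aliveW s t : s <= t -> alive t `<=` alive s.
Proof.
by move=> st w Ht r /andP[r0 rs]; apply: Ht; rewrite r0 (le_trans rs).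
Qed.

Lemma gap_continuous w s : s <= T ->
  {within `[0, s], continuous (fun r => u + W r w - g r)}.
Proof.
move=> sT.
have c1 : {within `[0, s], continuous (fun r => W r w)}.
  apply: (continuous_subspaceW _ (@bm_continuous _ _ _ _ _ hW w)).
  by move=> r /=; rewrite !in_itv /= andbT => /andP[].
have c2 : {within `[0, s], continuous g}.
  apply: (continuous_subspaceW _ hg).
  by move=> r /=; rewrite !in_itv /= => /andP[-> /le_trans]; exact.
move=> r; apply: (@cvgB _ R); last exact: c2.
by apply: cvgD; [exact: cvg_cst|exact: c1].
Qed.

Lemma grid_dense s (f : R -> R) r : 0 <= s -> {within `[0, s], continuous f} ->
  0 <= r <= s -> forall e, 0 < e ->
  exists m k, (k <= 2 ^ m)%N /\ `|f r - f (grid s m k)| < e.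
Proof.
move=> s0 cf /andP[r0 rs] e e0.
have [s_0|sn0] := eqVneq s 0.
  have rE : r = 0 by apply/eqP; rewrite eq_le r0 -s_0 rs.
  by exists 0%N, 0%N; split => //; rewrite rE /grid mul0r mulr0 subrr normr0.
have sp : 0 < s by rewrite lt_neqAle eq_sym sn0.
have rin : r \in `[0, s] by rewrite in_itv /= r0.
have cr := iffLR (subspace_continuousP _ _) cf r rin.
have /cvgrPdist_lt/(_ _ e0) := cr.
rewrite near_withinE => /nbhs_ballP[dl /= dl0 Hdl].
have [m Hm] : exists m : nat, s / 2 ^+ m < dl.
  exists (Num.truncn (s / dl)).+1.
  rewrite ltr_pdivrMr ?exprn_gt0// mulrC -ltr_pdivrMr//.
  apply: lt_trans (truncnS_gt _) _; rewrite -natrX ltr_nat; exact: ltn_expl.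
pose q := r / s * 2 ^+ m.
have q0 : 0 <= q by rewrite mulr_ge0 ?exprn_ge0// divr_ge0.
have /andP[q1 q2] := truncn_itv q0.
have p0 : 0 < 2 ^+ m :> R by rewrite exprn_gt0.
have km : (Num.truncn q <= 2 ^ m)%N.
  rewrite -(ler_nat R) (le_trans q1)// natrX /q ler_piMl ?exprn_ge0//.
  by rewrite ler_pdivrMr// mul1r.
exists m, (Num.truncn q); split => //.
have gE : grid s m (Num.truncn q) = s / 2 ^+ m * (Num.truncn q)%:R.
  by rewrite /grid mulrA mulrAC.
have rE : r = s / 2 ^+ m * q.
  have := lt0r_neq0 p0; rewrite /q; set p := 2 ^+ m => pn0.
  by field; rewrite pn0 sn0.
apply: (Hdl (grid s m (Num.truncn q))); rewrite /=.
  rewrite /ball /= rE gE -mulrBr normrM ger0_norm; last by rewrite divr_ge0// ltW.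
  apply: le_lt_trans Hm; rewrite ler_piMr ?divr_ge0 ?(ltW p0)//.
  by rewrite ger0_norm ?subr_ge0// lerBlDl natr1 ltW.
rewrite in_itv /= grid_ge0//= gE -[leRHS](divfK (lt0r_neq0 p0)) ler_wpM2l//.
  by rewrite divr_ge0// ltW.
by rewrite -natrX ler_nat.
Qed.

(** By compactness, the boundary is reached on [[0, s]] if and only if [u +
    W - g] exceeds every negative level somewhere on the interval, and by
    continuity somewhere on a dyadic grid.  This turns an uncountable
    condition into countable set operations. *)
Lemma alive_past s : 0 <= s -> s <= T -> <<s past W s >> (alive s).
Proof.
move=> s0 sT.
pose E j m k := [set w | - (j.+1%:R)^-1 < u + W (grid s m k) w - g (grid s m k)].
have aE : alive s = ~` (\bigcap_j \bigcup_m \bigcup_(k in [set k | (k <= 2 ^ m)%N]) E j m k).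
  rewrite -[LHS]setCK; congr (~` _); apply/seteqP; split => w /=.
    move=> /existsNP[r /not_implyP[/andP[r0 rs] /negP]]; rewrite -leNgt => gr j _.
    have rr : 0 <= r <= s by rewrite r0.
    have e0 : 0 < (j.+1%:R)^-1 :> R by rewrite invr_gt0.
    have [m [k [km Hk]]] := grid_dense s0 (@gap_continuous w s sT) rr e0.
    exists m => //; exists k => //; rewrite /E /=.
    move: Hk; rewrite ltr_norml => /andP[_ Hk].
    by move: Hk gr => /=; move: (_^-1) (W _ _) (W _ _) (g (grid _ _ _)) => *; lra.
  move=> H Ha.
  have [c cs Hc] := EVT_max s0 (@gap_continuous w s sT).
  have : u + W c w - g c < 0.
    by rewrite subr_lt0; apply: Ha; move: cs; rewrite in_itv.
  set M := _ - g c in Hc * => M0.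
  have Mi : 0 < - M by rewrite oppr_gt0.
  pose j := Num.truncn (- M)^-1.
  have [m _ [k /= km]] := H j I; rewrite /E /= => Hj.
  have Hg : grid s m k \in `[0, s].
    rewrite in_itv /= grid_ge0//= -[leRHS](grid_end s m) /grid ler_wpM2l//.
    by rewrite ler_pM2r ?invr_gt0 ?exprn_gt0// ler_nat.
  have := lt_le_trans Hj (Hc _ Hg); rewrite ltrNl => H2.
  have : (- M)^-1 < j.+1%:R by rewrite truncnS_gt.
  by rewrite invf_plt ?posrE// => H3; move: (lt_trans H2 H3); rewrite ltxx.
rewrite aE.
apply: (@measurableC _ (g_sigma_algebraType (past W s))).
apply: (@bigcap_measurable _ (g_sigma_algebraType (past W s))) => // j _.
apply: (@bigcup_measurable _ (g_sigma_algebraType (past W s))) => m _.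
apply: (@bigcup_measurable _ (g_sigma_algebraType (past W s))) => k km.
have mZ : measurable_fun setT
    ((fun w => u + W (grid s m k) w - g (grid s m k)) : g_sigma_algebraType (past W s) -> R).
  apply: measurable_funB; last exact: measurable_cst.
  by apply: measurable_funD; [exact: measurable_cst|exact: (past_grid hW s0 km)].
have -> : E j m k = setT `&` (fun w => u + W (grid s m k) w - g (grid s m k)) @^-1`
    `]- (j.+1%:R)^-1, +oo[%classic.
  by apply/seteqP; split => w /=; rewrite in_itv /= andbT => // -[].
exact: mZ.
Qed.

End Alive.

(** * Bounded convergence and hitting times of a path *)

Lemma bounded_convergence {R : realType} {d} {Y : measurableType d}
    (P : probability Y R) (D : set Y) (f_ : nat -> Y -> R) (f : Y -> R) (C : R) :
  measurable D -> (forall n, measurable_fun D (f_ n)) ->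
  (forall n y, D y -> `|f_ n y| <= C) ->
  (forall y, D y -> f_ n y @[n --> \oo] --> f y) ->
  measurable_fun D f /\
  \int[P]_(y in D) f_ n y @[n --> \oo] --> \int[P]_(y in D) f y.
Proof.
move=> mD mf_ fC cf.
have mf : measurable_fun D f by exact: measurable_fun_cvg mf_ cf.
split => //; apply: fine_cvg.
have fb y : D y -> `|f y| <= C.
  move=> Dy; have cn : `|f_ n y| @[n --> \oo] --> `|f y| by apply: cvg_norm; exact: cf.
  by apply: (cvgr_to_le cn); near=> n; exact: fC.
have := @dominated_convergence _ _ _ P D mD (fun n => EFin \o f_ n) (EFin \o f)
  (EFin \o (fun=> C)).
case.
- by move=> n; apply/measurable_EFinP.
- exact/measurable_EFinP.
- by apply: aeW => y Dy; apply: cvg_EFin; [exact: nearW|exact: cf].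
- exact: finite_measure_integrable_cst.
- by apply: aeW => y n Dy; rewrite /= lee_fin fC.
move=> _ _; rewrite fineK//.
by apply: integrable_fin_num => //; apply: (@bounded_integrable _ _ _ _ _ _ C).
Unshelve. all: by end_near. Qed.

Lemma cvg_within_seq {R : realType} (A : set R) (f : R -> R) (x l : R) (x_ : nat -> R) :
  f z @[z --> within A (nbhs x)] --> l -> x_ n @[n --> \oo] --> x ->
  (forall n, A (x_ n)) -> f (x_ n) @[n --> \oo] --> l.
Proof.
move=> fl xx Ax; apply/cvgrPdist_lt => e e0.
have /cvgrPdist_lt/(_ _ e0) := fl; rewrite near_withinE => H.
have H2 := xx _ H; near=> n.
have : A (x_ n) -> `|l - f (x_ n)| < e by near: n; exact: H2.
by apply.
Unshelve. all: by end_near. Qed.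

Section HittingTime.
Context {R : realType}.
Variables (T : R) (g w : R -> R) (u : R).
Hypothesis T0 : 0 < T.
Hypothesis w0 : w 0 = 0.
Hypothesis ug : u <= g 0.
Hypothesis gap_cont : {within `[0, T], continuous (fun r => u + w r - g r)}.

Let tau := hitting_time T g w u.
Let hits := [set t | 0 <= t < T /\ u + w t = g t].

Lemma hitting_time_le t : hits t -> tau <= t.
Proof.
move=> Ht; rewrite /tau /hitting_time -/hits.
case: asboolP => [_|]; last by case; exists t.
by apply: ge_inf => //; exists 0 => r [/andP[]].
Qed.

Lemma hitting_time_itv : 0 <= tau <= T.
Proof.
rewrite /tau /hitting_time -/hits; case: asboolP => [h0|_]; last by rewrite lexx ltW.
apply/andP; split.
  by apply: lb_le_inf => // r [/andP[]].
have [r Hr] := h0; apply: (@le_trans _ _ r).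
  by apply: ge_inf => //; exists 0 => z [/andP[]].
by case: Hr => /andP[_ /ltW].
Qed.

(** The infimum is a hit because a point at which the continuous gap does
    not vanish has a neighbourhood without hits. *)
Lemma hitting_time_hit : tau < T -> u + w tau = g tau.
Proof.
move=> tT; have /andP[t0 tle] := hitting_time_itv.
have h0 : hits !=set0.
  apply: contrapT => nh; move: tT; rewrite /tau /hitting_time -/hits.
  by case: asboolP => // _; rewrite ltxx.
have tE : tau = inf hits by rewrite /tau /hitting_time -/hits; case: asboolP.
have hinf : has_inf hits by split => //; exists 0 => z [/andP[]].
apply/eqP; rewrite -subr_eq0; apply/negPn/negP => n0.
have ct := iffLR (subspace_continuousP _ _) gap_cont tau.
have tin : `[0, T]%classic tau by rewrite /= in_itv /= t0.
have p0 : 0 < `|u + w tau - g tau| by rewrite normr_gt0.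
have /cvgrPdist_lt/(_ _ p0) := ct tin.
rewrite near_withinE => /nbhs_ballP[dl /= dl0 Hdl].
have [h Hh hlt] := inf_adherent dl0 hinf.
have th : tau <= h by exact: hitting_time_le.
have [/andP[h1 h2] Hg] := Hh.
have hb : ball tau dl h.
  by rewrite /ball /= ler0_norm ?subr_le0// opprB ltrBlDl tE.
have hin : `[0, T]%classic h by rewrite /= in_itv /= h1 ltW.
by have := Hdl h hb hin; rewrite /from_subspace /= Hg subrr subr0 ltxx.
Qed.

(** The path starts below the boundary, so by the intermediate value theorem
    it cannot get above it without a hit. *)
Lemma alive_hitting_time t : 0 <= t < T ->
  (forall r, 0 <= r <= t -> u + w r < g r) <-> t < tau.
Proof.
move=> /andP[t0 tT]; split => [al|tt r /andP[r0 rt]].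
  rewrite ltNge; apply/negP => taut.
  have tauT := le_lt_trans taut tT.
  have /andP[tau0 _] := hitting_time_itv.
  have := al tau; rewrite tau0 taut => /(_ isT).
  by rewrite (hitting_time_hit tauT) ltxx.
rewrite ltNge; apply/negP => gr.
have rT : r < T by exact: le_lt_trans tT.
have cr : {within `[0, r], continuous (fun r => u + w r - g r)}.
  apply: (continuous_subspaceW _ gap_cont) => z /=; rewrite !in_itv /=.
  by move=> /andP[-> /le_trans -> //]; exact: ltW.
have a0 : u + w 0 - g 0 <= 0 by rewrite w0 addr0 subr_le0.
have ar : 0 <= u + w r - g r by rewrite subr_ge0.
have [|c] := IVT (v := 0) r0 cr.
  by rewrite ge_min a0 /= le_max ar orbT.
rewrite in_itv /= => /andP[c0 cr'] /eqP; rewrite subr_eq0 => /eqP ce.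
have /hitting_time_le : hits c by split => //; rewrite c0 (le_lt_trans cr').
by rewrite leNgt (le_lt_trans cr')// (le_lt_trans rt).
Qed.

Lemma hitting_time_below t : 0 <= t -> t <= tau -> t < T -> u + w t <= g t.
Proof.
move=> t0; rewrite le_eqVlt => /orP[/eqP ->|tt] tT.
  by rewrite hitting_time_hit.
have tt' : 0 <= t < T by rewrite t0.
by apply/ltW/((alive_hitting_time tt').2 tt); rewrite t0 lexx.
Qed.

End HittingTime.

(** * Stopping U at the hitting time *)

Section StoppedExtension.
Context {R : realType} {d : measure_display} {Omega : measurableType d}.
Variables (P : probability Omega R) (W : R -> Omega -> R).
Hypothesis hW : brownian_motion P W.
Variables (T : R) (g : R -> R) (u : R).
Hypothesis T0 : 0 < T.
Hypothesis hg : {within `[0, T], continuous g}.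
Hypothesis ug : u <= g 0.

Definition tau w := hitting_time T g (fun t => W t w) u.

Let gapT w : {within `[0, T], continuous (fun r => u + W r w - g r)}.
Proof. exact: (@gap_continuous _ _ _ _ _ hW T g u hg w T (lexx T)). Qed.

Let w0 w : W 0 w = 0. Proof. exact: (bm_start hW). Qed.

Lemma tau_itv w : 0 <= tau w <= T.
Proof. exact: hitting_time_itv. Qed.

Lemma tau_hit w : tau w < T -> u + W (tau w) w = g (tau w).
Proof. exact: (hitting_time_hit T0 (@gapT w)). Qed.

Lemma tau_below w t : 0 <= t -> t <= tau w -> t < T -> u + W t w <= g t.
Proof. exact: (hitting_time_below T0 (w0 w) ug (@gapT w)). Qed.

Lemma alive_tau w t : 0 <= t < T -> alive W g u t w <-> t < tau w.
Proof. exact: (alive_hitting_time T0 (w0 w) ug (@gapT w)). Qed.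

Lemma measurable_alive t : 0 <= t -> t <= T -> measurable (alive W g u t).
Proof.
move=> t0 tT; apply: (sigma_past_measurable hW t0).
exact: (@alive_past _ _ _ _ _ hW T g u hg t t0 tT).
Qed.

Let near_T (j : nat) : R := T - T / j.+2%:R.

Let near_T_itv j : 0 <= near_T j < T.
Proof.
rewrite /near_T subr_ge0 ltrBlDr ltrDl divr_gt0 ?ltr0n// andbT.
by rewrite ler_pdivrMr ?ltr0n// ler_peMr ?(ltW T0)// ler1n.
Qed.

Let near_T_close e : 0 < e -> \forall j \near \oo, T - near_T j < e.
Proof.
move=> e0; exists (Num.truncn (T / e)) => // j /= Hj.
rewrite /near_T opprB addrC subrK ltr_pdivrMr ?ltr0n// mulrC -ltr_pdivrMr//.
by apply: lt_le_trans (truncnS_gt _) _; rewrite ler_nat ltnS ltnW.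
Qed.

Let near_T_cvg : near_T j @[j --> \oo] --> T.
Proof.
apply/cvgrPdist_lt => e e0; apply: filterS (near_T_close e0) => j.
by rewrite gtr0_norm// subr_gt0; case/andP: (near_T_itv j).
Qed.

Section OneDistribution.
Variable mu : schwartz_distribution R.
Hypothesis cmu : compact (dist_supp mu).
Hypothesis smu : dist_supp mu `<=` `[g T, +oo[.

Let F x t := U T x t mu.
Let FX t w := F (u + W t w) t.

Lemma measurable_U t : t < T -> measurable_fun setT (fun x => U T x t mu).
Proof.
move=> tT; apply: continuous_measurable_fun.
have [L _ HL] := U_lipschitz cmu smu tT.
exact: lipschitz_continuous HL.
Qed.

Let measurable_FX t : 0 <= t -> t < T -> measurable_fun setT (FX t).
Proof.
move=> t0 tT; apply: (measurableT_comp (measurable_U tT)).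
apply: measurable_funD; first exact: measurable_cst.
exact: (bm_measurable hW).
Qed.

(** Conditioning on the past of [s] replaces [F(u + W_t, t)] by its Gaussian
    average around [u + W_s], which is [F(u + W_s, s)]. *)
Lemma U_martingale s t : 0 <= s -> s <= t -> t < T ->
  \int[P]_w (\1_(alive W g u s) w * (FX t w - FX s w)) = 0.
Proof.
move=> s0; rewrite le_eqVlt => /orP[/eqP <- tT|st tT].
  under eq_Rintegral do rewrite subrr mulr0.
  exact: (Rintegral_cst1 P).
have t0 : 0 <= t by rewrite ltW// (le_lt_trans s0).
have sT : s < T by exact: lt_trans tT.
have [C C0 HC] := U_bounded cmu smu tT.
have mf : measurable_fun setT (fun x => U T (u + x) t mu).
  apply: (measurableT_comp (measurable_U tT)).
  by apply: measurable_funD; [exact: measurable_cst|exact: measurable_id].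
have mA : measurable (alive W g u s) by apply: measurable_alive => //; exact: ltW.
have b1 r w : r <= t -> `|\1_(alive W g u s) w * FX r w| <= C.
  move=> rt; rewrite normrM indicE; case: (_ \in _); rewrite ?normr1 ?mul1r ?normr0 ?mul0r//.
  exact: HC.
have m1 r : 0 <= r -> r < T -> measurable_fun setT (fun w => \1_(alive W g u s) w * FX r w).
  move=> r0 rT; apply: measurable_funM; last exact: measurable_FX.
  exact: measurable_indic.
under eq_Rintegral do rewrite mulrBr.
rewrite RintegralB//; last 2 first.
- by apply: (@bounded_integrable _ _ _ P setT _ C) => //; [exact: m1|move=> w _; exact: b1].
- apply: (@bounded_integrable _ _ _ P setT _ C) => //; first exact: m1.
  by move=> w _; apply: b1; exact: ltW.
apply/eqP; rewrite subr_eq0; apply/eqP.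
have := markov_property hW s0 st (@alive_past _ _ _ _ _ hW T g u hg s s0 (ltW sT)) mf (fun x => HC (u + x) t (lexx t)).
rewrite /FX /F => ->; apply: eq_Rintegral => w _; congr (_ * _).
have conv z := heat_convolution hW z s0 st tT.
rewrite (U_semigroup (u + W s w) cmu smu sT tT conv).
by apply: eq_Rintegral => y _; rewrite addrA.
Qed.

Section StoppedSum.
Variables (s : R) (N : nat).
Hypothesis s0 : 0 <= s.
Hypothesis sT : s < T.

Let tt i : R := s * (i%:R / N.+1%:R).

(** A discrete stochastic integral: the increments of [F(u + W_t, t)] over
    the grid steps that begin before the hitting time. *)
Definition stopped_sum k w := F u 0 +
  \sum_(i < k) \1_(alive W g u (tt i)) w * (FX (tt i.+1) w - FX (tt i) w).

Let tt_ge0 i : 0 <= tt i.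
Proof. by rewrite /tt mulr_ge0// divr_ge0. Qed.

Let tt_le i j : (i <= j)%N -> tt i <= tt j.
Proof. by move=> ij; rewrite /tt ler_wpM2l// ler_pM2r ?invr_gt0// ler_nat. Qed.

Let tt_end : tt N.+1 = s.
Proof. by rewrite /tt divff ?mulr1// pnatr_eq0. Qed.

Let tt_les i : (i <= N.+1)%N -> tt i <= s.
Proof. by move=> iN; rewrite -tt_end tt_le. Qed.

Let ttT i : (i <= N.+1)%N -> tt i < T.
Proof. by move=> iN; exact: le_lt_trans (tt_les iN) sT. Qed.

Let sum_recr (f : nat -> R) a k :
  a + \sum_(i < k.+1) f i = a + \sum_(i < k) f i + f k.
Proof. by rewrite big_ord_recr /= addrA. Qed.

Lemma stopped_sumS k w : stopped_sum k.+1 w = stopped_sum k w +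
  \1_(alive W g u (tt k)) w * (FX (tt k.+1) w - FX (tt k) w).
Proof.
exact: (sum_recr (fun i => \1_(alive W g u (tt i)) w * (FX (tt i.+1) w - FX (tt i) w))).
Qed.

(** The indicators are 1 up to a first grid time and 0 from then on, so the
    sum telescopes to the value at that time. *)
Lemma stopped_sum_path k w : (k <= N.+1)%N -> exists j, [/\ (j <= k)%N,
  stopped_sum k w = FX (tt j) w, (forall i, (i < j)%N -> alive W g u (tt i) w) &
  j = k \/ ~ alive W g u (tt j) w].
Proof.
elim: k => [_|k IH kN].
  exists 0%N; split => //; last by left.
  by rewrite /stopped_sum big_ord0 addr0 /FX /tt mul0r mulr0 w0 addr0.
have [j [jk Sj al jd]] := IH (ltnW kN).
have [ak|nak] := pselect (alive W g u (tt k) w).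
  have jE : j = k.
    case: jd => // na; exfalso; apply: na; apply: aliveW ak; exact: tt_le.
  exists k.+1; split; [exact: leqnn| | |by left].
    rewrite stopped_sumS Sj jE indicE mem_set// mul1r.
    by move: (FX _ w) (FX _ w) => a b; rewrite addrC subrK.
  move=> i; rewrite ltnS leq_eqVlt => /orP[/eqP ->//|ik].
  by apply: al; rewrite jE.
exists j; split => //; first exact: leq_trans jk _.
  by rewrite stopped_sumS indicE memNset// mul0r addr0.
by right; case: jd => [->|].
Qed.

Lemma stopped_sum_measurable k : (k <= N.+1)%N -> measurable_fun setT (stopped_sum k).
Proof.
elim: k => [_|k IH kN].
  rewrite (_ : stopped_sum 0 = cst (F u 0)); first exact: measurable_cst.
  by apply/funext => w; rewrite /stopped_sum big_ord0 addr0.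
rewrite (_ : stopped_sum k.+1 = (stopped_sum k \+ (fun w =>
    \1_(alive W g u (tt k)) w * (FX (tt k.+1) w - FX (tt k) w)))).
  apply: measurable_funD; first exact: IH (ltnW kN).
  apply: measurable_funM.
    apply: measurable_indic; apply: measurable_alive => //.
    by rewrite ltW// ttT// ltnW.
  by apply: measurable_funB; apply: measurable_FX => //; apply: ttT => //; exact: ltnW.
by apply/funext => w; exact: stopped_sumS.
Qed.

Lemma stopped_sum_bounded C k w : (forall x t, t <= s -> `|U T x t mu| <= C) ->
  (k <= N.+1)%N -> `|stopped_sum k w| <= C.
Proof.
move=> HC kN; have [j [jk -> _ _]] := stopped_sum_path w kN.
by apply: HC; apply: tt_les; exact: leq_trans kN.
Qed.

Lemma stopped_sum_mean k : (k <= N.+1)%N -> \int[P]_w stopped_sum k w = F u 0.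
Proof.
have [C C0 HC] := U_bounded cmu smu sT.
elim: k => [_|k IH kN].
  rewrite -[RHS](Rintegral_cst1 P); apply: eq_Rintegral => w _.
  by rewrite /stopped_sum big_ord0 addr0.
have i1 j : (j <= N.+1)%N -> P.-integrable setT (EFin \o stopped_sum j).
  move=> jN; apply: (@bounded_integrable _ _ _ P setT _ C) => //.
    exact: stopped_sum_measurable.
  by move=> w _; exact: stopped_sum_bounded.
have D w : \1_(alive W g u (tt k)) w * (FX (tt k.+1) w - FX (tt k) w) =
    stopped_sum k.+1 w - stopped_sum k w.
  rewrite stopped_sumS; move: (stopped_sum k w) (_ * _) => a b.
  by rewrite addrAC subrr add0r.
have := U_martingale (tt_ge0 k) (tt_le (leqnSn k)) (ttT kN).
under eq_Rintegral do rewrite D.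
rewrite RintegralB//; [|exact: i1|by apply: i1; exact: ltnW].
by move/eqP; rewrite subr_eq0 IH ?(ltnW kN)// => /eqP.
Qed.

Lemma stopped_sum_close w : exists rho, [/\ 0 <= rho <= s,
  `|rho - Num.min (tau w) s| <= s / N.+1%:R & stopped_sum N.+1 w = FX rho w].
Proof.
have [j [jN Sj al jd]] := stopped_sum_path w (leqnn N.+1).
exists (tt j); split => //; first by rewrite tt_ge0 tt_les.
have aT i : (i <= N.+1)%N -> 0 <= tt i < T by move=> iN; rewrite tt_ge0 ttT.
have step i : tt i.+1 = tt i + s / N.+1%:R.
  by rewrite /tt -natr1 mulrDl mulrDr mul1r.
have /andP[tau0 tauT] := tau_itv w.
have d0 : 0 <= s / N.+1%:R by rewrite divr_ge0.
have upper : Num.min (tau w) s <= tt j.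
  case: jd => [->|na]; first by rewrite tt_end ge_min lexx orbT.
  rewrite ge_min; apply/orP; left; rewrite leNgt; apply/negP => tj.
  by apply: na; apply/(alive_tau w (aT _ jN)).
rewrite ger0_norm ?subr_ge0// lerBlDr.
case: j jN al {Sj jd} upper => [_ _ _|j jN al _].
  have -> : tt 0 = 0 by rewrite /tt mul0r mulr0.
  by rewrite addr_ge0// le_min tau0.
rewrite step addrC lerD2l le_min tt_les ?(ltnW jN)// andbT ltW//.
by apply/(alive_tau w (aT _ (ltnW jN))); exact: al.
Qed.

End StoppedSum.

Lemma FX_continuous s w r : 0 <= r <= s -> s < T ->
  FX z w @[z --> within `[0, s] (nbhs r)] --> FX r w.
Proof.
move=> /andP[r0 rs] sT.
have rT : r < T by exact: le_lt_trans sT.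
have cW : {within `[0, s], continuous (fun t => W t w)}.
  apply: (continuous_subspaceW _ (@bm_continuous _ _ _ _ _ hW w)).
  by move=> z /=; rewrite !in_itv /= andbT => /andP[].
have cWr : W z w @[z --> within `[0, s] (nbhs r)] --> W r w.
  by apply: (iffLR (subspace_continuousP _ _) cW r); rewrite /= in_itv /= r0.
have cid : z @[z --> within `[0, s] (nbhs r)] --> r.
  by apply: cvg_within_filter; exact: cvg_id.
have c1 : (u + W z w, z) @[z --> within `[0, s] (nbhs r)] --> (u + W r w, r).
  have c0 : u + W z w @[z --> within `[0, s] (nbhs r)] --> u + W r w.
    by apply: cvgD => //; exact: cvg_cst.
  exact: (cvg_pair c0 cid).
have c2 := @U_continuous R T (g T) mu cmu smu (u + W r w) r rT.
have c3 := cvg_comp _ _ c1 c2.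
exact: c3.
Qed.

(** Refining the grid with [s] fixed.  Rounding the hitting time up may
    carry the path above the boundary, hence the domination by [U_bounded],
    whose constant depends on [s], instead of a bound valid below the
    boundary. *)
Lemma stopped_mean s : 0 <= s -> s < T ->
  measurable_fun setT (fun w => FX (Num.min (tau w) s) w) /\
  \int[P]_w FX (Num.min (tau w) s) w = U T u 0 mu.
Proof.
move=> s0 sT; have [C C0 HC] := U_bounded cmu smu sT.
have [] := @bounded_convergence R d Omega P setT (fun n => stopped_sum s n n.+1)
  (fun w => FX (Num.min (tau w) s) w) C measurableT.
- by move=> n; exact: stopped_sum_measurable.
- by move=> n w _; exact: stopped_sum_bounded.
- move=> w _.
  have smin : 0 <= Num.min (tau w) s <= s.
    have /andP[tau0 _] := tau_itv w.
    by rewrite le_min tau0 s0 ge_min lexx orbT.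
  have cFX := @FX_continuous s w _ smin sT.
  apply/cvgrPdist_lt => e e0.
  have /cvgrPdist_lt/(_ _ e0) := cFX.
  rewrite near_withinE => /nbhs_ballP[dl /= dl0 Hdl].
  exists (Num.truncn (s / dl)) => // n /= Hn.
  have [rho [/andP[r0 rs] Hr ->]] := @stopped_sum_close s n s0 sT w.
  apply: (Hdl rho); last by rewrite /= in_itv /= r0.
  rewrite /ball /= distrC; apply: (le_lt_trans Hr).
  rewrite ltr_pdivrMr ?ltr0n// mulrC -ltr_pdivrMr//.
  by apply: lt_le_trans (truncnS_gt _) _; rewrite ler_nat.
move=> mV cV; split => //.
have cE : \int[P]_w stopped_sum s n n.+1 w @[n --> \oo] --> U T u 0 mu.
  rewrite (_ : (fun n => _) = fun=> U T u 0 mu); first exact: cvg_cst.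
  by apply/funext => n; exact: stopped_sum_mean.
exact: (cvg_unique _ cV cE).
Qed.

(** U has no limit at the corner (T, g T) in general; the paths that end
    there form a null set and are left aside. *)
Definition off_corner : set Omega := [set w | u + W T w != g T].

Lemma measurable_off_corner : measurable off_corner.
Proof.
have mW : measurable_fun setT (W T) by apply: (bm_measurable hW); exact: ltW.
have -> : off_corner = ~` (setT `&` W T @^-1` [set g T - u]).
  apply/seteqP; split => w /=.
    by move=> /eqP H [_ H2]; apply: H; rewrite H2 addrC subrK.
  by move=> H; apply/eqP => H2; apply: H; split => //; rewrite -H2 addrAC subrr add0r.
by apply: measurableC; exact: (mW measurableT _ (measurable_set1 _)).
Qed.

Lemma off_corner_null : P (~` off_corner) = 0%E.
Proof.
have h := bm_gaussian hW (lexx 0) T0 (measurable_set1 (g T - u)).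
(* [W_T - W_0] has a density. *)
have -> : ~` off_corner = [set w | [set g T - u] (W T w - W 0 w)].
  rewrite /off_corner; apply/seteqP; split => w /=; rewrite w0 subr0.
    by move=> /negP/negPn/eqP <-; rewrite addrAC subrr add0r.
  by move=> ->; rewrite addrC subrK eqxx.
rewrite h.
have /null_content_dominatesP H := @normal_prob_dominates R 0 (Num.sqrt (T - 0)).
by apply: H => //; exact: lebesgue_measure_set1.
Qed.

(** At the stopped times the path is on or below the boundary, so the bound
    [c] dominates uniformly as [s] tends to [T].  If tau < T the stopped
    values are eventually constant; if tau = T the path ends strictly below
    [g T], where [U_decay] gives the limit 0, the value that U takes at time
    [T] by convention. *)
Lemma stopped_limit (c : R) :
  (forall t x, 0 <= t < T -> x <= g t -> `|U T x t mu| <= c) ->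
  measurable_fun off_corner (fun w => U T (g (tau w)) (tau w) mu) /\
  \int[P]_(w in off_corner) U T (g (tau w)) (tau w) mu = U T u 0 mu.
Proof.
move=> hc; have mD := measurable_off_corner.
pose V j w := FX (Num.min (tau w) (near_T j)) w.
have mV j : measurable_fun setT (V j).
  by have /andP[a b] := near_T_itv j; exact: (stopped_mean a b).1.
have Vc j w : `|V j w| <= c.
  have /andP[a b] := near_T_itv j; have /andP[t0 _] := tau_itv w.
  have m0 : 0 <= Num.min (tau w) (near_T j) by rewrite le_min t0.
  have mT : Num.min (tau w) (near_T j) < T by rewrite gt_min b orbT.
  apply: hc; first by rewrite m0.
  by apply: tau_below => //; rewrite ge_min lexx.
have VD j : \int[P]_(w in off_corner) V j w = U T u 0 mu.
  have /andP[a b] := near_T_itv j; rewrite -(stopped_mean a b).2.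
  rewrite -[in RHS](setUv off_corner) Rintegral_setU//.
  - have := Rintegral_bound P (measurableC mD) (measurable_funTS (mV j)) (fun w _ => Vc j w).
    by rewrite off_corner_null mulr0 normr_le0 => /eqP ->; rewrite addr0.
  - exact: measurableC.
  - rewrite setUv; apply: (@bounded_integrable _ _ _ P setT _ c) => //.
      exact: mV.
    by move=> w _; exact: Vc.
  - by rewrite disj_set2E setICr.
have [] := @bounded_convergence R d Omega P off_corner V
  (fun w => U T (g (tau w)) (tau w) mu) c mD.
- by move=> j; apply: measurable_funTS; exact: mV.
- by move=> j w _; exact: Vc.
- move=> w Dw; have /andP[t0 tT] := tau_itv w.
  move: tT; rewrite le_eqVlt => /orP[/eqP tT|tT]; last first.
    apply: cvg_near_cst.
    have e0 : 0 < T - tau w by rewrite subr_gt0.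
    apply: filterS (near_T_close e0) => j hj.
    rewrite /V min_l; first by rewrite /FX /F tau_hit.
    by move: hj; rewrite ltrD2l ltrN2 => /ltW.
  have VE j : V j w = FX (near_T j) w.
    by rewrite /V tT min_r//; have /andP[_ /ltW] := near_T_itv j.
  have -> : U T (g (tau w)) (tau w) mu = 0 by rewrite /U tT ltxx.
  have TT : `[0, T]%classic T by rewrite /= in_itv /= lexx (ltW T0).
  have nT j : `[0, T]%classic (near_T j).
    by have /andP[a b] := near_T_itv j; rewrite /= in_itv /= a ltW.
  have cgap := cvg_within_seq (iffLR (subspace_continuousP _ _) (@gapT w) T TT) near_T_cvg nT.
  have cW : u + W (near_T j) w @[j --> \oo] --> u + W T w.
    apply: cvgD; first exact: cvg_cst.
    have inT t : `[0, T]%classic t -> `[0, +oo[%classic t.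
      by rewrite /= !in_itv /= andbT => /andP[].
    have cWT := iffLR (subspace_continuousP _ _)
      (@bm_continuous _ _ _ _ _ hW w) T (inT _ TT).
    exact: (cvg_within_seq cWT near_T_cvg (fun j => inT _ (nT j))).
  have XT : u + W T w < g T.
    rewrite lt_neqAle Dw /= -subr_le0.
    apply: (cvgr_to_le cgap); near=> j; rewrite subr_le0.
    have /andP[a b] := near_T_itv j.
    by apply: tau_below => //; rewrite tT ltW.
  apply/cvgr0Pnorm_le => e e0.
  have [dl dl0 Hdl] := U_decay T cmu smu XT e0.
  have h1 : \forall j \near \oo, `|u + W T w - (u + W (near_T j) w)| < dl.
    by have /cvgrPdist_lt/(_ _ dl0) := cW.
  apply: filterS2 h1 (near_T_close dl0) => j hj1 hj2.
  rewrite VE; apply: Hdl; first by rewrite distrC.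
  have /andP[a b] := near_T_itv j; rewrite b andbT.
  by rewrite ltrBlDr addrC -ltrBlDr.
move=> mU cU; split => //.
have cE : \int[P]_(w in off_corner) V j w @[j --> \oo] --> U T u 0 mu.
  rewrite (_ : (fun j => _) = fun=> U T u 0 mu); first exact: cvg_cst.
  by apply/funext => j; exact: VD.
exact: (cvg_unique _ cU cE).
Unshelve. all: by end_near. Qed.

End OneDistribution.

Lemma measurable_tau_lt : measurable [set w | tau w < T].
Proof.
have -> : [set w | tau w < T] = \bigcup_j ~` alive W g u (near_T j).
  apply/seteqP; split => w /=.
    move=> tT; have e0 : 0 < T - tau w by rewrite subr_gt0.
    exists (Num.truncn (T / (T - tau w))) => // al.
    have := (alive_tau w (near_T_itv _)).1 al; rewrite ltNge => /negP; apply.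
    rewrite /near_T lerBrDl -lerBrDr ler_pdivrMr ?ltr0n// mulrC -ler_pdivrMr//.
    by rewrite ltW// (lt_le_trans (truncnS_gt _))// ler_nat.
  move=> [j _ na]; have /andP[_ tT] := tau_itv w.
  move: tT; rewrite le_eqVlt => /orP[/eqP tT|//]; exfalso; apply: na.
  by apply/(alive_tau w (near_T_itv j)); rewrite tT; case/andP: (near_T_itv j).
apply: bigcup_measurable => j _; apply: measurableC; apply: measurable_alive.
  by case/andP: (near_T_itv j).
by case/andP: (near_T_itv j) => _ /ltW.
Qed.

End StoppedExtension.

(** * Convergence along the sequence of distributions *)

Theorem theorem2p5 (R : realType) (d : measure_display)
    (Omega : measurableType d) (P : probability Omega R) (W : R -> Omega -> R)
    (hW : brownian_motion P W)
    (T : R) (hT : 0 < T)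
    (g : R -> R) (hg : {within `[0, T], continuous g})
    (mu : nat -> schwartz_distribution R)
    (hmu_compact : forall n, compact (dist_supp (mu n)))
    (hmu_supp : forall n, dist_supp (mu n) `<=` `[g T, +oo[)
    (h_one : forall t : R, 0 <= t < T ->
       U T (g t) t (mu n) @[n --> \oo] --> (1 : R))
    (h_bounded : exists c : R, forall (n : nat) (t w : R),
       0 <= t < T -> w <= g t -> `|U T w t (mu n)| <= c)
    (u : R) (hu : u <= g 0) :
  (U T u 0 (mu n))%:E @[n --> \oo] -->
    P [set omega | hitting_time T g (fun t => W t omega) u < T].
Proof.
have [c hc] := h_bounded.
have c0 : 0 <= c.
  by apply: le_trans (normr_ge0 _) (hc 0%N 0 (g 0) _ _) => //; rewrite lexx.
pose D := off_corner W T g u; pose S := [set w | tau W T g u w < T].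
have mD : measurable D by exact: (measurable_off_corner hW).
have mS : measurable S by exact: (measurable_tau_lt hW hT hg hu).
pose G n w := U T (g (tau W T g u w)) (tau W T g u w) (mu n).
have lim n := stopped_limit hW hT hg hu (hmu_compact n) (hmu_supp n) (hc n).
have [] := @bounded_convergence R d Omega P D G \1_S c mD.
- by move=> n; exact: (lim n).1.
- move=> n w _; rewrite /G; have /andP[t0 tT] := @tau_itv _ _ _ W T g u hT w.
  move: tT; rewrite le_eqVlt => /orP[/eqP tT|tT]; last by apply: hc; rewrite ?t0.
  by rewrite /U tT ltxx normr0.
- move=> w _; rewrite /G indicE.
  have /andP[t0 tT] := @tau_itv _ _ _ W T g u hT w.
  move: tT; rewrite le_eqVlt => /orP[/eqP tT|tT].
    rewrite memNset; last by rewrite /S /= tT ltxx.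
    by under eq_fun do rewrite /U tT ltxx; exact: cvg_cst.
  by rewrite mem_set//; apply: h_one; rewrite t0.
move=> _ cG.
have GE : \int[P]_(w in D) \1_S w = fine (P S).
  rewrite /Rintegral integral_indic//; congr fine.
  have -> : P S = (P (S `\` D) + P (S `&` D))%E by exact: measureDI.
  rewrite [X in (X + _)%E](_ : _ = 0%E) ?add0e//.
  apply: (@subset_measure0 _ _ _ P _ (~` D)) => //.
  - exact: measurableD.
  - exact: measurableC.
  - exact: (off_corner_null hW g u hT).
have cU : U T u 0 (mu n) @[n --> \oo] --> fine (P S).
  rewrite -GE (_ : (fun n => U T u 0 (mu n)) = fun n => \int[P]_(w in D) G n w)//.
  by apply/funext => n; exact: (esym (lim n).2).
have -> : P [set omega | hitting_time T g (fun t => W t omega) u < T] = (fine (P S))%:E.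
  by rewrite fineK// fin_num_measure.
by apply: cvg_EFin; [exact: nearW|exact: cU].
Qed.
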